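(* Let $(p,<_p)$ be a weakly o-minimal pair over $A$, let $(D,<)$ be an $A$-definable linear order, and let $f:p(\mathfrak C)\to D$ be a relatively $A$-definable non-constant function. Then there exists $E\in\mathcal E_p\setminus\{\mathrm{id}_{p(\mathfrak C)}\}$ such that the restriction of $f$ to each $E$-class is either constant or strictly $(<_p,<)$-monotone.
   Context: $T$ is a complete first-order theory (possibly multi-sorted) with monster model $\mathfrak C$; $A$ is a small parameter set; ''definable'' means with parameters. For a partial type $p$ over $A$, $p(\mathfrak C)$ is its set of realizations; a subset of $p(\mathfrak C)$ (or relation on it, or function from it, via its graph) is relatively $B$-definable if it is the intersection of a $B$-definable set with $p(\mathfrak C)$ (resp. its appropriate power/product). A set in a linear order is convex if it contains all elements between any two of its elements; convex components are maximal convex subsets. A pair $(p,<_p)$ with $p\in S(A)$ and $<_p$ a relatively $A$-definable linear order on $p(\mathfrak C)$ is a weakly o-minimal pair over $A$ if every relatively definable (any parameters) subset of $p(\mathfrak C)$ has finitely many convex components in $(p(\mathfrak C),<_p)$. $\mathcal E_p$ is the set of relatively $A$-definable equivalence relations on $p(\mathfrak C)$, and $\mathrm{id}_{p(\mathfrak C)}$ is the identity relation. Strictly $(<_p,<)$-monotone means strictly increasing or strictly decreasing. *)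

(* Defs.v *)
From mathcomp Require Import all_boot.
From mathcomp Require Import boolp classical_sets functions cardinality.

Set Implicit Arguments.
Unset Strict Implicit.
Unset Printing Implicit Defensive.

Local Open Scope classical_set_scope.
Local Open Scope card_scope.

Record language := Language {
  lsort : Type;
  func : Type;
  fdom : func -> seq lsort;
  fcod : func -> lsort;
  rel_symb : Type;
  rdom : rel_symb -> seq lsort }.

(* [env X G] is the set of tuples x_1, ..., x_n with x_i in [X s_i], where
   G = [:: s_1; ...; s_n]. *)
Fixpoint env (S : Type) (X : S -> Type) (G : seq S) : Type :=
  if G is s :: G' then (X s * env X G')%type else unit.

Fixpoint env_cat (S : Type) (X : S -> Type) (G H : seq S) :
    env X G -> env X H -> env X (G ++ H) :=
  match G with
  | [::] => fun _ e => e
  | _ :: _ => fun d e => (d.1, env_cat d.2 e)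
  end.

Fixpoint env_map (S : Type) (X Y : S -> Type) (g : forall s, X s -> Y s)
    (G : seq S) : env X G -> env Y G :=
  match G with
  | [::] => fun _ => tt
  | _ :: _ => fun e => (g _ e.1, env_map g e.2)
  end.

Fixpoint env_in (S : Type) (X : S -> Type) (B : forall s, set (X s))
    (G : seq S) : env X G -> Prop :=
  match G with
  | [::] => fun _ => True
  | _ :: _ => fun e => B _ e.1 /\ env_in B e.2
  end.

(* De Bruijn variables of sort s in the context G. *)
Inductive var (S : Type) : seq S -> S -> Type :=
| VZ s G : var (s :: G) s
| VS s t G : var G s -> var (t :: G) s.

Fixpoint lookup (S : Type) (X : S -> Type) (G : seq S) (s : S) (x : var G s) :
    env X G -> X s :=
  match x with
  | VZ _ _ => fun e => e.1
  | VS _ _ _ y => fun e => lookup y e.2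
  end.

Inductive term (L : language) (G : seq (lsort L)) : lsort L -> Type :=
| Var s : var G s -> term G s
| App (h : func L) : terms G (fdom h) -> term G (fcod h)
with terms (L : language) (G : seq (lsort L)) : seq (lsort L) -> Type :=
| TNil : terms G [::]
| TCons s H : term G s -> terms G H -> terms G (s :: H).

Inductive formula (L : language) : seq (lsort L) -> Type :=
| Fls G : formula G
| Equ G s : term G s -> term G s -> formula G
| Rel G (r : rel_symb L) : terms G (rdom r) -> formula G
| Imp G : formula G -> formula G -> formula G
| All G s : formula (s :: G) -> formula G.

Arguments Fls {L G}.

Definition Neg (L : language) (G : seq (lsort L)) (phi : formula G) :=
  Imp phi Fls.

Record structure (L : language) := Structure {
  carrier :> lsort L -> Type;
  carrier_inh : forall s, inhabited (carrier s);
  fint : forall h : func L, env carrier (fdom h) -> carrier (fcod h);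
  rint : forall r : rel_symb L, set (env carrier (rdom r)) }.

Fixpoint eval (L : language) (M : structure L) (G : seq (lsort L)) (e : env M G)
    (s : lsort L) (t : term G s) : M s :=
  match t with
  | Var _ x => lookup x e
  | App h ts => fint (evals e ts)
  end
with evals (L : language) (M : structure L) (G : seq (lsort L)) (e : env M G)
    (H : seq (lsort L)) (ts : terms G H) : env M H :=
  match ts with
  | TNil => tt
  | TCons _ _ t ts' => (eval e t, evals e ts')
  end.

Fixpoint sat (L : language) (M : structure L) (G : seq (lsort L))
    (phi : formula G) : env M G -> Prop :=
  match phi with
  | Fls _ => fun _ => False
  | Equ _ _ t u => fun e => eval e t = eval e u
  | Rel _ r ts => fun e => rint (evals e ts)
  | Imp _ phi1 phi2 => fun e => sat phi1 e -> sat phi2 e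
  | All _ s phi1 => fun e => forall a : M s, sat (M := M) phi1 (a, e)
  end.

Definition theory (L : language) := set (@formula L [::]).

Definition models (L : language) (M : structure L) (T : theory L) :=
  forall phi, T phi -> sat (M := M) phi tt.

Definition complete_theory (L : language) (T : theory L) :=
  (exists M : structure L, models M T) /\
  forall phi : formula [::],
    (forall M : structure L, models M T -> sat (M := M) phi tt) \/
    (forall M : structure L, models M T -> sat (M := M) (Neg phi) tt).

Definition param (L : language) (M : structure L) (B : forall s, set (M s)) :=
  {s : lsort L & {a : M s | B s a}}.

(* The language L_B, with a new constant symbol for each element of B. *)
Definition expand (L : language) (M : structure L) (B : forall s, set (M s)) :
    language :=
  {| lsort := lsort L;
     func := (func L + param B)%type;
     fdom h := match h with inl h' => fdom h' | inr _ => [::] end;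
     fcod h := match h with inl h' => fcod h' | inr c => projT1 c end;
     rel_symb := rel_symb L;
     rdom := @rdom L |}.

Definition expansion (L : language) (M : structure L)
    (B : forall s, set (M s)) : structure (expand B) :=
  {| carrier := (carrier M : lsort (expand B) -> Type);
     carrier_inh := @carrier_inh L M;
     fint h :=
       match h with
       | inl h' => @fint L M h'
       | inr c => fun _ => proj1_sig (projT2 c)
       end;
     rint := @rint L M |}.

Section MonsterModel.
Variables (L : language) (M : structure L).

Definition partial_type (B : forall s, set (M s)) (G : seq (lsort L)) :=
  set (@formula (expand B) G).

Definition realizations (B : forall s, set (M s)) (G : seq (lsort L))
    (q : partial_type B G) : set (env M G) :=
  [set e | forall phi, q phi -> sat (M := expansion B) phi e].

Definition finitely_satisfiable (B : forall s, set (M s)) (G : seq (lsort L))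
    (q : partial_type B G) :=
  forall q0 : partial_type B G,
    finite_set q0 -> q0 `<=` q -> realizations q0 !=set0.

Definition complete_type (B : forall s, set (M s)) (G : seq (lsort L))
    (q : partial_type B G) :=
  finitely_satisfiable q /\ forall phi, q phi \/ q (Neg phi).

Definition elementary_map (B : forall s, set (M s))
    (g : forall s, M s -> M s) :=
  forall (G : seq (lsort L)) (phi : formula G) (e : env M G), env_in B e ->
    (sat phi e <-> sat phi (env_map g e)).

Definition automorphism (g : forall s, M s -> M s) :=
  [/\ forall s, bijective (g s),
      forall (h : func L) (e : env M (fdom h)),
        g _ (fint e) = fint (env_map g e)
    & forall (r : rel_symb L) (e : env M (rdom r)),
        rint e <-> rint (env_map g e)].

End MonsterModel.

Definition card_lt (X Y : Type) : Prop :=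
  [set: X] #<= [set: Y] /\ ~ ([set: Y] #<= [set: X]).

(* Cardinals are represented by types. *)
Definition small (kappa : Type) (L : language) (M : structure L)
    (B : forall s, set (M s)) := card_lt (param B) kappa.

Definition saturated (kappa : Type) (L : language) (M : structure L) :=
  forall (B : forall s, set (M s)) (G : seq (lsort L)) (q : partial_type B G),
    small kappa B -> finitely_satisfiable q -> realizations q !=set0.

(* A partial map with domain B is given by an arbitrary extension g of it to
   the whole of M. *)
Definition strongly_homogeneous (kappa : Type) (L : language)
    (M : structure L) :=
  forall (B : forall s, set (M s)) (g : forall s, M s -> M s),
    small kappa B -> elementary_map B g ->
    exists2 sigma : forall s, M s -> M s,
      automorphism sigma & forall s a, B s a -> sigma s a = g s a.

Definition monster (L : language) (T : theory L) (kappa : Type)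
    (M : structure L) :=
  [/\ models M T,
      card_lt {G : seq (lsort L) & formula G} kappa,
      saturated kappa M
    & strongly_homogeneous kappa M].

Section Definability.
Variables (L : language) (M : structure L).
Implicit Types (B : forall s, set (M s)) (G H : seq (lsort L)).

Definition definable B G (X : set (env M G)) :=
  exists phi : @formula (expand B) G,
    X = [set e | sat (M := expansion B) phi e].

Definition definable2 B G H (R : set (env M G * env M H)) :=
  exists phi : @formula (expand B) (G ++ H),
    R = [set de | sat (M := expansion B) phi (env_cat de.1 de.2)].

Definition rel_definable B G (P X : set (env M G)) :=
  exists2 Y, definable B Y & X = Y `&` P.

Definition rel_definable2 B G H (P : set (env M G)) (Q : set (env M H))
    (R : set (env M G * env M H)) :=
  exists2 S, definable2 B S & R = S `&` (P `*` Q).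

End Definability.

Section OrdersAndEquivalences.
Variable X : Type.
Implicit Types (P C Y : set X) (lt E : set (X * X)).

Definition linear_order P lt :=
  [/\ lt `<=` P `*` P,
      forall x, P x -> ~ lt (x, x),
      forall x y z, P x -> P y -> P z -> lt (x, y) -> lt (y, z) -> lt (x, z)
    & forall x y, P x -> P y -> [\/ lt (x, y), x = y | lt (y, x)]].

Definition convex P lt C :=
  C `<=` P /\
  forall x y z, C x -> P y -> C z -> lt (x, y) -> lt (y, z) -> C y.

Definition convex_components P lt Y : set (set X) :=
  [set C | [/\ convex P lt C, C `<=` Y
             & forall C', convex P lt C' -> C' `<=` Y -> C `<=` C' -> C' = C]].

Definition equivalence_on P E :=
  [/\ E `<=` P `*` P,
      forall x, P x -> E (x, x),
      forall x y, E (x, y) -> E (y, x)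
    & forall x y z, E (x, y) -> E (y, z) -> E (x, z)].

Definition id_on P : set (X * X) := [set xy | P xy.1 /\ xy.1 = xy.2].

End OrdersAndEquivalences.

Section WeaklyOMinimal.
Variables (L : language) (M : structure L) (A : forall s, set (M s)).
Variables (G : seq (lsort L)) (p : partial_type A G).

Definition weakly_o_minimal_pair (lt : set (env M G * env M G)) :=
  [/\ complete_type p,
      rel_definable2 A (realizations p) (realizations p) lt,
      linear_order (realizations p) lt
    & forall Y, rel_definable (fun=> setT) (realizations p) Y ->
        finite_set (convex_components (realizations p) lt Y)].

Definition definable_equivalences : set (set (env M G * env M G)) :=
  [set E | rel_definable2 A (realizations p) (realizations p) E /\
           equivalence_on (realizations p) E].

End WeaklyOMinimal.

Section Functions.
Variables (X Y : Type).
Implicit Types (K P : set X) (f : X -> Y).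

Definition graph_on P f : set (X * Y) := [set xy | P xy.1 /\ xy.2 = f xy.1].

Definition constant_on K f := forall x y, K x -> K y -> f x = f y.

Definition strictly_increasing_on K (lt : set (X * X)) (lt' : set (Y * Y)) f :=
  forall x y, K x -> K y -> lt (x, y) -> lt' (f x, f y).

Definition strictly_decreasing_on K (lt : set (X * X)) (lt' : set (Y * Y)) f :=
  forall x y, K x -> K y -> lt (x, y) -> lt' (f y, f x).

Definition strictly_monotone_on K (lt : set (X * X)) (lt' : set (Y * Y)) f :=
  strictly_increasing_on K lt lt' f \/ strictly_decreasing_on K lt lt' f.

End Functions.

(* Main.v *)
Require Import Defs.
From Stdlib Require List.
From mathcomp Require Import all_boot.
From mathcomp Require Import boolp classical_sets functions cardinality.

(* Let P = p(C).  The automorphisms over A act transitively on P, and an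
   invariant binary relation on P with one relatively definable fibre is
   relatively A-definable; so only the ordered set P, its relatively definable
   subsets (each of which has a one-sided germ at every point) and this action
   matter.  By homogeneity one of f y = f x, f y < f x, f y > f x holds for all
   x and all y < x close enough to x; call this relation R.  The key point is
   that an invariant relation S(y, x) which holds for every x and all y < x close
   to x also holds for every y and all x > y close to y.  Applied to
   "R(z, x) for all z in [y, x)", it yields to the right of every point an
   interval on which R(y, x) holds whenever y < x.  The equivalence relation
   "x and y are the endpoints of such an interval" then has the required
   properties. *)

Set Implicit Arguments.
Unset Strict Implicit.
Unset Printing Implicit Defensive.

Local Open Scope classical_set_scope.

(** * Environments and substitution *)

Scheme term_mind := Induction for term Sort Prop
  with terms_mind := Induction for terms Sort Prop.
Combined Scheme term_terms_ind from term_mind, terms_mind.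

Section Environments.
Variables (S : Type) (X : S -> Type).
Implicit Types (G H : seq S) (s t : S).

(** The index [s :: G] is not a variable, so the dependent match ranges over all contexts, with a
    trivial branch for the empty one. *)
Lemma var_consW s G (Q : forall t, var (s :: G) t -> Prop) :
  Q s (VZ s G) -> (forall t (v : var G t), Q t (VS s v)) ->
  forall t (v : var (s :: G) t), Q t v.
Proof.
move=> QZ QS t v.
refine (match v in var K u return
  match K return var K u -> Prop with
  | [::] => fun _ => True
  | a :: K' => fun w => forall Q' : (forall u, var (a :: K') u -> Prop),
      Q' a (VZ a K') -> (forall u (x : var K' u), Q' u (VS a x)) -> Q' u w
  end v with VZ a K' => _ | VS a b K' x => _ end Q QZ QS).
- by [].
- by move=> Q' _; apply.
Qed.

Fixpoint env_left G H : env X (G ++ H) -> env X G :=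
  match G with
  | [::] => fun _ => tt
  | _ :: _ => fun e => (e.1, env_left e.2)
  end.

Fixpoint env_right G H : env X (G ++ H) -> env X H :=
  match G with
  | [::] => fun e => e
  | _ :: _ => fun e => env_right e.2
  end.

Lemma env_left_cat G H (d : env X G) (e : env X H) :
  env_left (env_cat d e) = d.
Proof. by elim: G d => [[]//|s G IH] [a d] /=; rewrite IH. Qed.

Lemma env_right_cat G H (d : env X G) (e : env X H) :
  env_right (env_cat d e) = e.
Proof. by elim: G d => [[]//|s G IH] [a d] /=; rewrite IH. Qed.

Lemma env_map_cat (g : forall s, X s -> X s) G H (d : env X G) (e : env X H) :
  env_map g (env_cat d e) = env_cat (env_map g d) (env_map g e).
Proof. by elim: G d => [[]//|s G IH] [a d] /=; rewrite IH. Qed.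

Lemma env_map_comp (g h k : forall s, X s -> X s) G (e : env X G) :
  (forall s a, g s (h s a) = k s a) -> env_map g (env_map h e) = env_map k e.
Proof. by move=> ghk; elim: G e => [//|s G IH] [a e] /=; rewrite ghk IH. Qed.

Lemma env_map_id (g : forall s, X s -> X s) G (e : env X G) :
  (forall s a, g s a = a) -> env_map g e = e.
Proof. by move=> gid; elim: G e => [[]//|s G IH] [a e] /=; rewrite gid IH. Qed.

Lemma lookup_map (g : forall s, X s -> X s) G s (v : var G s) (e : env X G) :
  lookup v (env_map g e) = g s (lookup v e).
Proof. by elim: v e => [{}s {}G|{}s t {}G v IH] [a e] //=. Qed.

Lemma env_ext G (d e : env X G) :
  (forall s (v : var G s), lookup v d = lookup v e) -> d = e.
Proof.
elim: G d e => [[] []//|s G IH] [a d] [b e] de.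
have /= -> := de _ (VZ s G); congr pair; apply: IH => t v.
exact: (de _ (VS s v)).
Qed.

Lemma env_in_lookup (B : forall s, set (X s)) G (e : env X G) :
  env_in B e -> forall s (v : var G s), B s (lookup v e).
Proof.
move=> Be s v; elim: v e Be => [{}s {}G|{}s t {}G v IH] [a e] /= [] //.
by move=> _ /IH.
Qed.

End Environments.

(** * Substituting terms with parameters into formulas *)

Section Substitution.
Variables (L : language) (M : structure L).
Implicit Types (B : forall s, set (M s)) (G H K : seq (lsort L)).
Implicit Types (l : seq {s : lsort L & M s}).

Definition term_fun B K s (F : env M K -> M s) :=
  exists t : @term (expand B) K s,
    forall e, eval (M := expansion B) e t = F e.

(** Substitution is kept semantic: a tuple of terms over [B] appears only through the map of
    environments that it induces. *)
Definition subst_fun B K G (g : env M K -> env M G) :=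
  forall s (v : var G s), term_fun B (fun e => lookup v (g e)).

Definition all_in B l := forall c, List.In c l -> B (projT1 c) (projT2 c).

Lemma all_in_cat B l1 l2 : all_in B (l1 ++ l2) <-> all_in B l1 /\ all_in B l2.
Proof.
split=> [Bl|[Bl1 Bl2] c /List.in_app_iff[/Bl1//|/Bl2//]].
by split=> c lc; apply: Bl; apply/List.in_app_iff; [left|right].
Qed.

Lemma term_fun_const B K s (a : M s) :
  B s a -> term_fun B (fun _ : env M K => a).
Proof.
move=> Ba.
by exists (@App (expand B) K (inr (existT _ s (exist _ a Ba))) (TNil _)).
Qed.

Lemma subst_fun_id B K : subst_fun B (fun e : env M K => e).
Proof. by move=> s v; exists (Var (L := expand B) v). Qed.

Lemma subst_fun_snd B K s : subst_fun B (fun e : env M (s :: K) => e.2).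
Proof. by move=> t v; exists (Var (L := expand B) (VS s v)). Qed.

Lemma term_fun_subst_L K :
  (forall s (t : @term L K s) B G (g : env M G -> env M K),
     subst_fun B g -> term_fun B (fun e => eval (g e) t)) /\
  (forall H (ts : @terms L K H) B G (g : env M G -> env M K),
     subst_fun B g -> exists ts' : @terms (expand B) G H,
       forall e, evals (M := expansion B) e ts' = evals (g e) ts).
Proof.
apply: term_terms_ind => [s v B G g /(_ s v)//|h ts IH B G g gs||
    s H t IHt ts IHts B G g gs].
- have [ts' ts'E] := IH B G g gs.
  by exists (@App (expand B) G (inl h) ts') => e /=; rewrite ts'E.
- by move=> B G g _; exists (TNil _).
- have [[t' t'E] [ts' ts'E]] := (IHt B G g gs, IHts B G g gs).
  by exists (TCons t' ts') => e /=; rewrite t'E ts'E.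
Qed.

(* [l] lists the constants of the term. *)
Lemma term_fun_subst_consts B K :
  (forall s (t : @term (expand B) K s), exists2 l, all_in B l &
     forall B' G (g : env M G -> env M K), all_in B' l -> subst_fun B' g ->
       term_fun B' (fun e => eval (M := expansion B) (g e) t)) /\
  (forall H (ts : @terms (expand B) K H), exists2 l, all_in B l &
     forall B' G (g : env M G -> env M K), all_in B' l -> subst_fun B' g ->
       exists ts' : @terms (expand B') G H, forall e,
         evals (M := expansion B') e ts' = evals (M := expansion B) (g e) ts).
Proof.
apply: term_terms_ind => [s v|[h|c] ts [l Bl IH]||
    s H t [l Bl IHt] ts [l' Bl' IHts]].
- by exists [::] => // B' G g _ /(_ s v).
- exists l => // B' G g B'l gs.
  have [ts' ts'E] := IH B' G g B'l gs.
  by exists (@App (expand B') G (inl h) ts') => e /=; rewrite ts'E.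
- case: c ts IH => s [a Ba] ts _ /=.
  exists [:: existT _ s a] => [_ [<-//|//]|B' G g B'l gs].
  apply: term_fun_const; exact: (B'l (existT _ s a) (or_introl erefl)).
- by exists [::] => // B' G g _ _; exists (TNil _).
- exists (l ++ l'); first by apply/all_in_cat.
  move=> B' G g /all_in_cat[B'l B'l'] gs.
  have [[t' t'E] [ts' ts'E]] := (IHt B' G g B'l gs, IHts B' G g B'l' gs).
  by exists (TCons t' ts') => e /=; rewrite t'E ts'E.
Qed.

Lemma term_fun_comp B B' K G s (F : env M K -> M s) (g : env M G -> env M K) :
  (forall s a, B s a -> B' s a) -> term_fun B F -> subst_fun B' g ->
  term_fun B' (fun e => F (g e)).
Proof.
move=> BB' [t tF] gs; have [l Bl lt] := (term_fun_subst_consts B K).1 s t.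
have B'l : all_in B' l by move=> c /Bl/BB'.
by have [t' t'E] := lt B' G g B'l gs; exists t' => e; rewrite t'E tF.
Qed.

Lemma subst_fun_under B K G s (g : env M G -> env M K) :
  subst_fun B g ->
  subst_fun B (fun e : env M (s :: G) => (e.1, g e.2) : env M (s :: K)).
Proof.
move=> gs t v.
elim/var_consW: v => [|{}t v]; first by exists (Var (L := expand B) (VZ s G)).
exact: (term_fun_comp (fun _ _ h => h) (gs t v) (@subst_fun_snd B G s)).
Qed.

(** Formulas of [L] itself are treated separately because [elementary_map] quantifies over them. *)
Lemma definable_subst_L K (phi : @formula L K) B G (g : env M G -> env M K) :
  subst_fun B g -> definable B [set e | sat phi (g e)].
Proof.
elim: phi B G g => [{}K|{}K s t u|{}K r ts|{}K phi1 IH1 phi2 IH2|{}K s phi IH]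
  B G g gs.
- by exists Fls.
- have [[t' t'E] [u' u'E]] :=
    ((term_fun_subst_L K).1 s t B G g gs, (term_fun_subst_L K).1 s u B G g gs).
  by exists (Equ t' u'); apply/seteqP; split=> e /=; rewrite t'E u'E.
- have [ts' ts'E] := (term_fun_subst_L K).2 _ ts B G g gs.
  exists (@Rel (expand B) G r ts').
  by apply/seteqP; split=> e /=; rewrite ts'E.
- have [[psi1 E1] [psi2 E2]] := (IH1 B G g gs, IH2 B G g gs).
  exists (Imp psi1 psi2); apply/seteqP.
  move/seteqP: E1 => [E1 E1']; move/seteqP: E2 => [E2 E2'].
  split=> e /= h s1; first exact: E2 _ (h (E1' _ s1)).
  exact: E2' _ (h (E1 _ s1)).
- have [psi /seteqP[E1 E2]] := IH B _ _ (subst_fun_under (s := s) gs).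
  exists (All psi); apply/seteqP; split=> e /= h a.
  + exact: (E1 (a, e)).
  + exact: (E2 (a, e)).
Qed.

(** The list of constants depends on [phi] alone and is chosen before [B'] and [g]. This one
    induction therefore gives preimages, change of parameters and finiteness of the parameter
    set. *)
Lemma definable_subst_consts B K (phi : @formula (expand B) K) :
  exists2 l, all_in B l &
    forall B' G (g : env M G -> env M K), all_in B' l -> subst_fun B' g ->
      definable B' [set e | sat (M := expansion B) phi (g e)].
Proof.
elim: phi => [{}K|{}K s t u|{}K r ts|{}K phi1 [l1 Bl1 IH1] phi2 [l2 Bl2 IH2]|
    {}K s phi [l Bl IH]].
- by exists [::] => // B' G g _ gs; exists Fls.
- have [l Bl lt] := (term_fun_subst_consts B K).1 s t.
  have [l' Bl' lu] := (term_fun_subst_consts B K).1 s u.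
  exists (l ++ l'); first by apply/all_in_cat.
  move=> B' G g /all_in_cat[B'l B'l'] gs.
  have [[t' t'E] [u' u'E]] := (lt B' G g B'l gs, lu B' G g B'l' gs).
  by exists (Equ t' u'); apply/seteqP; split=> e /=; rewrite t'E u'E.
- have [l Bl lt] := (term_fun_subst_consts B K).2 _ ts.
  exists l => // B' G g B'l gs; have [ts' ts'E] := lt B' G g B'l gs.
  exists (@Rel (expand B') G r ts').
  by apply/seteqP; split=> e /=; rewrite ts'E.
- exists (l1 ++ l2); first by apply/all_in_cat.
  move=> B' G g /all_in_cat[B'l1 B'l2] gs.
  have [[psi1 E1] [psi2 E2]] := (IH1 B' G g B'l1 gs, IH2 B' G g B'l2 gs).
  exists (Imp psi1 psi2); apply/seteqP.
  move/seteqP: E1 => [E1 E1']; move/seteqP: E2 => [E2 E2'].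
  split=> e /= h s1; first exact: E2 _ (h (E1' _ s1)).
  exact: E2' _ (h (E1 _ s1)).
- exists l => // B' G g B'l gs.
  have [psi /seteqP[E1 E2]] := IH B' _ _ B'l (subst_fun_under (s := s) gs).
  exists (All psi); apply/seteqP; split=> e /= h a.
  + exact: (E1 (a, e)).
  + exact: (E2 (a, e)).
Qed.

Lemma definable_preimage B B' K G (X : set (env M K)) (g : env M G -> env M K) :
  (forall s a, B s a -> B' s a) -> definable B X -> subst_fun B' g ->
  definable B' (g @^-1` X).
Proof.
move=> BB' [phi ->] gs; have [l Bl lphi] := definable_subst_consts phi.
by apply: (lphi B' G g) => // c /Bl/BB'.
Qed.

(** A formula mentions finitely many constants; this brings arbitrary parameters back to a small
    set. *)
Lemma definable_finite_params B K (X : set (env M K)) :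
  definable B X -> exists2 l, all_in B l &
    forall B', all_in B' l -> definable B' X.
Proof.
move=> [phi ->]; have [l Bl lphi] := definable_subst_consts phi.
by exists l => // B' B'l; exact: lphi B'l (@subst_fun_id B' K).
Qed.

Lemma subst_fun_cat B K G H (g : env M K -> env M G) (h : env M K -> env M H) :
  subst_fun B g -> subst_fun B h ->
  subst_fun B (fun e => env_cat (g e) (h e)).
Proof.
elim: G g => [//|s G IH] g gs hs t v.
elim/var_consW: v => [|{}t v]; first exact: (gs s (VZ s G)).
apply: (IH (fun e => (g e).2)) => // u w; exact: (gs u (VS s w)).
Qed.

Lemma subst_fun_const B K G (d : env M G) :
  env_in B d -> subst_fun B (fun _ : env M K => d).
Proof. by move=> Bd s v; exact: term_fun_const (env_in_lookup Bd v). Qed.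

Lemma subst_fun_left B G H : subst_fun B (@env_left _ M G H).
Proof.
elim: G => [|s G IH] t v /=; first by inversion v.
elim/var_consW: v => [|{}t v]; first by exists (Var (L := expand B) (VZ s _)).
exact: (term_fun_comp (fun _ _ h => h) (IH t v) (@subst_fun_snd B (G ++ H) s)).
Qed.

Lemma subst_fun_right B G H : subst_fun B (@env_right _ M G H).
Proof.
elim: G => [|s G IH] t v /=; first exact: subst_fun_id.
exact: (term_fun_comp (fun _ _ h => h) (IH t v) (@subst_fun_snd B (G ++ H) s)).
Qed.

End Substitution.

(** * Finiteness and small sets *)

Section Cardinality.
Local Open Scope card_scope.

(** Combines finitely many conditions, each met somewhere in [Q], when any two points of [Q] have a
    common refinement. It serves both for intervals shrinking to a point and for filter bases of
    definable sets. *)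
Lemma finite_directed (I J : Type) (F : set I) (Q : set J)
    (Phi : I -> J -> Prop) :
  finite_set F -> Q !=set0 ->
  (forall c d, Q c -> Q d -> exists2 e, Q e &
     (forall i, Phi i c -> Phi i e) /\ (forall i, Phi i d -> Phi i e)) ->
  (forall i, F i -> exists2 c, Q c & Phi i c) ->
  exists2 c, Q c & forall i, F i -> Phi i c.
Proof.
move=> Ffin [c0 Qc0] Qdir FPhi.
have /finite_set_leP[n /pcard_leP[g]] := Ffin.
(* Members of [F] are handled in the order of their images under the injection [g] into the integers
   below [n]. *)
suff : forall m, exists2 c, Q c & forall i, F i -> (g i < m)%N -> Phi i c.
  move=> /(_ n)[c Qc cP]; exists c => // i Fi.
  by apply: (cP i Fi); exact: ('funS_g Fi).
elim=> [|m [c Qc cP]]; first by exists c0.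
have [[i [Fi gim]]|noi] := pselect (exists i, F i /\ g i = m); last first.
  exists c => // i Fi; rewrite ltnS leq_eqVlt => /orP[/eqP gim|/cP//]; last exact.
  by case: noi; exists i.
have [d Qd id] := FPhi i Fi; have [e Qe [ce de]] := Qdir c d Qc Qd.
exists e => // j Fj; rewrite ltnS leq_eqVlt => /orP[/eqP gjm|/cP cPj].
  suff -> : j = i by exact: de.
  by apply: ('inj_g); rewrite ?inE //; exact: etrans gjm _.
by apply: ce; exact: cPj.
Qed.

Lemma inj_card_leT (X Y : Type) (h : X -> Y) :
  injective h -> [set: X] #<= [set: Y].
Proof.
move=> hinj; rewrite -(card_le_eql (inj_card_eq (f := h) (A := setT) _)).
  exact: card_leT.
by move=> x y _ _ /hinj.
Qed.

(** Hilbert's hotel along an injection [i] of [nat]: [None] goes to [i 0], each [i n] to [i n.+1],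
    and other points stay. *)
Lemma option_card_le (X : Type) :
  infinite_set [set: X] -> [set: option X] #<= [set: X].
Proof.
elim/Ppointed: X => X; first by rewrite emptyE; case; exact: finite_set0.
move=> /infiniteP/pcard_leP[i].
have iinj m n : i m = i n -> m = n by apply: inj; rewrite inE.
pose h (o : option X) := if o is Some x then
    if pselect (exists n, i n = x) is left e then i (projT1 (cid e)).+1 else x
  else i 0.
apply: (@inj_card_leT _ _ h) => -[x|] [y|] //=.
- case: pselect => [ex|nx]; case: pselect => [ey|ny].
  + case: cid => m /= <-; case: cid => n /= <- /iinj [->] //.
  + by move=> E; case: ny; eexists; exact: E.
  + by move=> E; case: nx; eexists; rewrite E.
  + by move=> ->.
- case: pselect => [ex /iinj //|nx E]; by case: nx; exists 0.
- case: pselect => [ex /iinj //|nx E]; by case: nx; exists 0.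
Qed.

(** Adjoining one point cannot reach the infinite cardinal [K]: it keeps a finite set finite and
    makes an infinite set no larger. *)
Lemma card_lt_option (X Y K : Type) :
  [set: nat] #<= [set: K] -> [set: Y] #<= [set: option X] ->
  card_lt X K -> card_lt Y K.
Proof.
move=> natK YX [XK nKX]; have [Xfin|Xinf] := pselect (finite_set [set: X]).
  have oXfin : finite_set [set: option X].
    have -> : [set: option X] = None |` (some @` [set: X]).
      by apply/seteqP; split=> // -[x|] _; [right; exists x|left].
    by rewrite finite_setU; split; [exact: finite_set1|exact: finite_image].
  have Yfin := card_le_finite YX oXfin.
  split; first exact: card_le_trans (finite_set_countable Yfin) natK.
  by move=> KY; apply: infinite_nat;
    exact: card_le_finite (card_le_trans natK KY) Yfin.
have YX' := card_le_trans YX (option_card_le Xinf).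
split; first exact: card_le_trans XK.
by move=> KY; apply: nKX; exact: card_le_trans YX'.
Qed.

Fixpoint imp_depth (L : language) (G : seq (lsort L)) (phi : formula G) : nat :=
  if phi is Imp _ psi _ then (imp_depth psi).+1 else 0.

(** Iterated negations of [Fls], told apart by [imp_depth], give infinitely many formulas in any
    language. *)
Lemma nat_card_le_formulas (L : language) (K : Type) :
  card_lt {G : seq (lsort L) & formula G} K -> [set: nat] #<= [set: K].
Proof.
move=> [LK _]; apply: card_le_trans LK.
pose h n : {G : seq (lsort L) & formula G} :=
  existT _ [::] (iter n (fun phi => Neg phi) Fls).
apply: (@inj_card_leT _ _ h).
apply: (@can_inj _ _ _ (fun c => imp_depth (projT2 c))) => n /=.
by elim: n => //= n ->.
Qed.

End Cardinality.

(** * Saturation and homogeneity *)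

Section DefinableSets.
Variables (L : language) (M : structure L).
Implicit Types (B : forall s, set (M s)) (G H K : seq (lsort L)).

Lemma definableC B K (X : set (env M K)) : definable B X -> definable B (~` X).
Proof. by move=> [phi ->]; exists (Neg phi). Qed.

Lemma definableI B K (X Y : set (env M K)) :
  definable B X -> definable B Y -> definable B (X `&` Y).
Proof.
move=> [phi ->] [psi ->]; exists (Neg (Imp phi (Neg psi))).
apply/seteqP; split=> e /=; first by move=> [h1 h2] h; exact: (h h1 h2).
by move=> h; split; apply: contrapT => nh; apply: h.
Qed.

Lemma definableT B K : definable B [set: env M K].
Proof. by exists (Neg Fls); apply/seteqP; split=> // e _ /=. Qed.

Lemma definable_exists B H G (X : set (env M (H ++ G))) :
  definable B X -> definable B [set e | exists v, X (env_cat v e)].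
Proof.
elim: H X => [|s H IH] X.
  move=> [phi ->]; exists phi; apply/seteqP; split=> e /= => [[_ //]|h].
  by exists tt.
move=> [phi XE].
have /IH : definable B [set e : env M (H ++ G) | exists a, X (a, e)].
  exists (Neg (All (Neg phi))); rewrite XE; apply/seteqP; split=> e /=.
    by move=> [a h] /(_ a).
  by move=> h; apply: contrapT => nh; apply: h => a Xa; apply: nh; exists a.
congr definable; apply/seteqP; split=> e /=;
  first by move=> [v [a]]; exists (a, v).
by move=> [[a v]]; exists v, a.
Qed.

Lemma sub_definable B B' K (X : set (env M K)) :
  (forall s a, B s a -> B' s a) -> definable B X -> definable B' X.
Proof. by move=> BB' /definable_preimage; apply=> //; exact: subst_fun_id. Qed.

Lemma env_in_of_lookup B G (e : env M G) :
  (forall s (v : var G s), B s (lookup v e)) -> env_in B e.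
Proof.
elim: G e => [//|s G IH] [a e] Be; split; first exact: (Be s (VZ s G)).
by apply: IH => t v; exact: (Be t (VS s v)).
Qed.

Lemma env_in_setT G (e : env M G) : env_in (fun=> setT) e.
Proof. exact: env_in_of_lookup. Qed.

End DefinableSets.

(** * Automorphisms over a set of parameters *)

Section Automorphisms.
Variables (L : language) (M : structure L).
Implicit Types (B : forall s, set (M s)) (G H K : seq (lsort L)).

Definition fixing_automorphism B (g : forall s, M s -> M s) :=
  automorphism g /\ forall s a, B s a -> g s a = a.

Variables (B : forall s, set (M s)) (g : forall s, M s -> M s).
Hypothesis gB : fixing_automorphism B g.

Lemma eval_aut K :
  (forall s (t : @term (expand B) K s) (e : env M K),
     eval (M := expansion B) (env_map g e) t
     = g (eval (M := expansion B) e t)) /\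
  (forall H (ts : @terms (expand B) K H) (e : env M K),
     evals (M := expansion B) (env_map g e) ts
     = env_map g (evals (M := expansion B) e ts)).
Proof.
have [[_ gf _] gfix] := gB.
apply: term_terms_ind => [s v e|[h|[s [a Ba]]] ts IH e|//|s H t IHt ts IHts e] /=.
- exact: lookup_map.
- by rewrite IH gf.
- by rewrite gfix.
- by rewrite IHt IHts.
Qed.

Lemma sat_aut K (phi : @formula (expand B) K) (e : env M K) :
  sat (M := expansion B) phi (env_map g e) <-> sat (M := expansion B) phi e.
Proof.
have [[gbij gf gr] gfix] := gB.
elim: phi e => [{}K //|{}K s t u|{}K r ts|{}K phi1 IH1 phi2 IH2|{}K s phi IH] e /=.
- have [E _] := eval_aut K; rewrite !E.
  by split=> [|->//]; have [h hK _] := gbij s; move/(congr1 h); rewrite !hK.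
- by have [_ E] := eval_aut K; rewrite E; apply: iff_sym; exact: gr.
- by have [h1 h2] := IH1 e; have [h3 h4] := IH2 e; split; auto.
- have [h hK gK] := gbij s; split=> H a.
    by apply/IH => /=; exact: H.
  by rewrite -(gK a); apply/(IH (h a, e)).
Qed.

Lemma definable_aut K (X : set (env M K)) e :
  definable B X -> X (env_map g e) <-> X e.
Proof. by move=> [phi ->]; exact: sat_aut. Qed.

Lemma fixing_automorphism_inv : exists2 h, fixing_automorphism B h &
  (forall s, cancel (@g s) (@h s)) /\ forall s, cancel (@h s) (@g s).
Proof.
have [[gbij gf gr] gfix] := gB.
have ginv s : exists h, cancel (@g s) h /\ cancel h (@g s).
  by have [h gK hK] := gbij s; exists h.
pose h s := projT1 (cid (ginv s)).
have gh s : cancel (@g s) (h s) by rewrite /h; case: cid => ? [].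
have hg s : cancel (h s) (@g s) by rewrite /h; case: cid => ? [].
have hE G (e : env M G) : env_map g (env_map h e) = e.
  by rewrite (env_map_comp (k := fun s a => a)) ?env_map_id.
exists h => //; split; last by move=> s a Ba; rewrite -[in LHS](gfix s a Ba) gh.
split=> [s|k e|r e]; first by exists (@g s).
  by rewrite -{1}(hE _ e) -gf gh.
by have := gr r (env_map h e); rewrite hE; exact: iff_sym.
Qed.

End Automorphisms.

Section Monster.
Variables (L : language) (T : theory L) (kappa : Type) (M : structure L).
Hypothesis hM : monster T kappa M.
Implicit Types (B : forall s, set (M s)) (G H K : seq (lsort L)).

Lemma small_add1 B B' (c : {s : lsort L & M s}) :
  (forall s a, B' s a -> B s a \/ existT _ s a = c) ->
  small kappa B -> small kappa B'.
Proof.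
move=> BB'; have [_ LK _ _] := hM.
apply: card_lt_option (nat_card_le_formulas LK) _.
(* [None] receives the only point that may lie outside [B]. *)
pose h (x : param B') : option (param B) :=
  if pselect (B _ (proj1_sig (projT2 x))) is left Bx
  then Some (existT _ (projT1 x) (exist _ _ Bx)) else None.
have E (d e : {s : lsort L & M s}) (Bd : B' _ (projT2 d)) (Be : B' _ (projT2 e)) :
    d = e -> existT _ _ (exist _ (projT2 d) Bd) =
             existT _ _ (exist _ (projT2 e) Be) :> param B'.
  by move=> de; subst e; rewrite (Prop_irrelevance Bd Be).
apply: (@inj_card_leT _ _ h) => -[s [a Ba]] [t [b Bb]]; rewrite /h /=.
case: pselect => ha; case: pselect => hb // hE;
  apply: (E (existT _ s a) (existT _ t b) Ba Bb).
  exact: (congr1 (fun o : option (param B) => if o is Some x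
    then existT (fun s => M s) (projT1 x) (proj1_sig (projT2 x))
    else existT _ s a) hE).
by case: (BB' s a Ba) => [//|->]; case: (BB' t b Bb) => [//|->].
Qed.

Definition add_params B (l : seq {s : lsort L & M s}) s : set (M s) :=
  [set a | B s a \/ List.In (existT _ s a) l].

Lemma small_add_params B l : small kappa B -> small kappa (add_params B l).
Proof.
move=> hB; elim: l => [|c l IH].
  suff -> : add_params B [::] = B by [].
  by apply: functional_extensionality_dep => s; apply/seteqP; split=> a;
    [case|left].
apply: (small_add1 (c := c)) IH => s a [Ba|[->|la]]; [left; left|right|left; right] => //.
Qed.

Fixpoint entries G : env M G -> seq {s : lsort L & M s} :=
  match G with
  | [::] => fun _ => [::]
  | s :: _ => fun e => existT _ s e.1 :: entries e.2
  end.

Lemma In_entries G (e : env M G) s (a : M s) :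
  List.In (existT _ s a) (entries e) <-> exists v : var G s, a = lookup v e.
Proof.
elim: G s a e => [|t G IH] s a [] /=; first by split=> // -[v]; inversion v.
move=> b e; split.
  case=> [E|/IH[v ->]]; last by exists (VS t v).
  have : exists v : var (t :: G) t, b = lookup v (b, e) by exists (VZ t G).
  (* [E] equates dependent pairs; a predicate on pairs is transported along it without separating
     the components. *)
  pose Q c := exists v : var (t :: G) (projT1 c), projT2 c = lookup v (b, e).
  by rewrite -[X in X -> _]/(Q (existT _ t b)) E.

move=> [v ->] {a}; elim/var_consW: v => [|{}s v /=]; first by left.
by right; apply/IH; exists v.
Qed.

(** Fixing [B] and sending [d] to [e] is a partial elementary map, to which strong homogeneity
    applies. One implication suffices because definable sets are closed under complement. *)
Lemma homogeneous B K (d e : env M K) : small kappa B ->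
  (forall X, definable B X -> X d -> X e) ->
  exists2 g, fixing_automorphism B g & env_map g d = e.
Proof.
move=> hB de; have [_ _ _ hom] := hM.
have de' X : definable B X -> X d <-> X e.
  move=> dX; split; first exact: de.
  by move=> Xe; apply: contrapT => /(de _ (definableC dX)).
pose B' := add_params B (entries d).
(* Every point of [B'] is the value at [d] of a term over [B]; [h] will send it to the value of that
   term at [e]. Outside [B'] the choice is a dummy. *)
have tB' s : exists F : M s -> env M K -> M s,
    forall a, B' s a -> term_fun B (F a) /\ F a d = a.
  suff /choice[F FP] : forall a, exists F : env M K -> M s,
      B' s a -> term_fun B F /\ F d = a by exists F.
  move=> a.
  have [[Ba|/In_entries[v ->]]|nB'a] := pselect (B' s a).
  - by exists (fun=> a) => _; split=> //; exact: term_fun_const.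
  - by exists (lookup v) => _; split=> //; exact: subst_fun_id.
  - by exists (fun=> a).
have [F FP] : exists F : forall s, M s -> env M K -> M s,
    forall s a, B' s a -> term_fun B (F s a) /\ F s a d = a.
  have F' s := cid (tB' s).
  by exists (fun s => projT1 (F' s)) => s; exact: (projT2 (F' s)).
pose h s a := F s a e.
(* Entries of [d] may repeat or lie in [B], so one point can come from several terms; the value at
   [e] does not depend on the choice. *)
have term_eq s (F1 F2 : env M K -> M s) : term_fun B F1 -> term_fun B F2 ->
    F1 d = F2 d -> F1 e = F2 e.
  move=> [t1 E1] [t2 E2]; apply: (de [set x | F1 x = F2 x]).
  by exists (Equ t1 t2); apply/seteqP; split=> x /=; rewrite E1 E2.
(* A tuple in [B'] is a substitution evaluated at [d] and its image the same substitution at [e], so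
   a formula about them becomes one about [d] and [e] over [B]. *)
have hB' : elementary_map B' h.
  move=> G phi x B'x.
  have [r [rs rd rh]] : exists r : env M K -> env M G,
      [/\ subst_fun B r, r d = x & r e = env_map h x].
    exists (fun y => env_map (fun s a => F s a y) x); split.
    + move=> s v; have [[t tE] _] := FP s _ (env_in_lookup B'x v).
      by exists t => y; rewrite tE lookup_map.
    + apply: env_ext => s v; rewrite lookup_map.
      by have [_ ->] := FP s _ (env_in_lookup B'x v).
    + by [].
  by have := de' _ (definable_subst_L phi rs); rewrite /= rd rh.
have [g gaut gh] := hom B' h (small_add_params (entries d) hB) hB'.
exists g; first split=> // s a Ba.
  rewrite gh; last by left.
  have [tF Fd] := FP s a (or_introl Ba).
  exact: (term_eq s _ (fun=> a) tF (term_fun_const _ Ba)).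
apply: env_ext => s v; rewrite lookup_map.
have B'v : B' s (lookup v d) by right; apply/In_entries; exists v.
have [tF Fd] := FP s _ B'v.
rewrite gh //; exact: (term_eq s _ (lookup v) tF (@subst_fun_id _ M B K s v) Fd).
Qed.

(** The formulas defining members of [F] form a type, and [finite_directed] finds a member of [F]
    inside any finite part of it. *)
Lemma saturation_filter B K (F : set (set (env M K))) : small kappa B ->
  F !=set0 -> (forall X, F X -> definable B X) ->
  (forall X, F X -> X !=set0) ->
  (forall X Y, F X -> F Y -> exists2 Z, F Z & Z `<=` X /\ Z `<=` Y) ->
  exists e, forall X, F X -> X e.
Proof.
move=> hB F0 Fdef Fne Fdir; have [_ _ hsat _] := hM.
pose q : partial_type B K := [set phi | F [set e | sat (M := expansion B) phi e]].
have [|e eq] := hsat B K q hB; last first.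
  exists e => X FX; have [phi XE] := Fdef X FX.
  by rewrite XE; apply: eq; rewrite /q /= -XE.
move=> q0 q0fin q0q.
have [||X FX XP] := @finite_directed _ _ q0 F
  (fun phi X => X `<=` [set e | sat (M := expansion B) phi e]) q0fin F0.
- move=> X Y FX FY; have [Z FZ [ZX ZY]] := Fdir X Y FX FY.
  by exists Z => //; split=> phi h e /[dup] Ze; [move=> /ZX/h|move=> /ZY/h].
- by move=> phi /q0q qphi; exists [set e | sat (M := expansion B) phi e].
- by have [e Xe] := Fne X FX; exists e => phi /XP; apply.
Qed.

End Monster.

(** * Orders with finitely many convex components *)

Section WeaklyOMinimalFamilies.
Variables (X : Type) (P : set X).
Implicit Types (lt : set (X * X)) (dset : set (set X)) (Y C : set X).

Definition rev_order lt : set (X * X) := [set xy | lt (xy.2, xy.1)].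

(** The interval from [a] to [c], open at [a] and closed at [c]: it is nonempty as soon as
    [lt (a, c)], without any density. *)
Definition lopen lt a c : set X := [set x | lt (a, x) /\ (x = c \/ lt (x, c))].

(** Isolates what the order arguments use of the relatively definable subsets of the locus, which
    are the intended [dset]. *)
Definition weakly_o_minimal_family lt dset :=
  [/\ linear_order P lt,
      forall Y, dset Y -> Y `<=` P /\ finite_set (convex_components P lt Y),
      forall Y Z, dset Y -> dset Z -> dset (Y `&` Z),
      forall Y, dset Y -> dset (P `\` Y)
    & forall a, P a -> dset [set x | lt (x, a)] /\ dset [set x | lt (a, x)]].

Lemma rev_convex lt C : convex P (rev_order lt) C <-> convex P lt C.
Proof.
by split=> -[CP Cc]; split=> // x y z Cx Py Cz xy yz; exact: (Cc z y x).
Qed.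

Lemma rev_linear_order lt : linear_order P lt -> linear_order P (rev_order lt).
Proof.
move=> [ltP irr tr tot]; split.
- by move=> [x y] /ltP[].
- by move=> x Px; exact: irr.
- by move=> x y z Px Py Pz xy yz; exact: (tr z y x).
- by move=> x y Px Py; case: (tot x y Px Py); [constructor 3|constructor 2|constructor 1].
Qed.

Lemma rev_weakly_o_minimal_family lt dset :
  weakly_o_minimal_family lt dset -> weakly_o_minimal_family (rev_order lt) dset.
Proof.
move=> [lin dP dI dC dray]; split=> //; first exact: rev_linear_order.
  move=> Y /dP[YP fin]; split=> //; move: fin; congr finite_set.
  apply/seteqP; split=> C [cC CY Cmax]; split=> [|//|C' cC' C'Y CC'];
    by [apply/rev_convex|apply: Cmax => //; apply/rev_convex].
by move=> a /dray[].
Qed.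

(** The union of all convex subsets of [Y] through [x] is convex, since an intermediate point lies
    between [x] and a point of one of them. *)
Lemma convex_component_exists lt Y x :
  linear_order P lt -> Y `<=` P -> Y x ->
  exists2 C, convex_components P lt Y C & C x.
Proof.
move=> [ltP irr tr tot] YP Yx.
pose C : set X := [set y | exists C', [/\ convex P lt C', C' `<=` Y, C' x & C' y]].
have CxI C' y : convex P lt C' -> C' `<=` Y -> C' x -> C' y -> C y.
  by move=> *; exists C'.
have Cx : C x.
  exists [set x]; split=> // [|_ ->//]; split=> [_ ->|_ y _ -> Py -> xy yx].
    exact: YP.
  by have Px := YP x Yx; case: (irr x Px (tr x y x Px Py Px xy yx)).
exists C => //; split.
- split=> [y [C' [_ C'Y _ /C'Y/YP//]]|].
  move=> y z w [C1 [c1 C1Y C1x C1y]] Pz [C2 [c2 C2Y C2x C2w]] yz zw.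
  have Px := YP x Yx; case: (tot x z Px Pz) => [xz|<-//|zx].
    by exists C2; split=> //; exact: (c2.2 x z w).
  by exists C1; split=> //; exact: (c1.2 y z x).
- by move=> y [C' [_ C'Y _ /C'Y]].
- move=> C' c' C'Y CC'; apply/seteqP; split=> // y C'y.
  exact: (CxI C' y c' C'Y (CC' x Cx) C'y).
Qed.

Variables (lt : set (X * X)) (dset : set (set X)).
Hypothesis fam : weakly_o_minimal_family lt dset.

Let ltP x y : lt (x, y) -> P x /\ P y.
Proof. by case: fam => -[h _ _ _] _ _ _ _ /h. Qed.

Let lt_irr x : ~ lt (x, x).
Proof. by case: fam => -[_ h _ _] _ _ _ _ /[dup] /ltP[Px _]; exact: h. Qed.

Let lt_tr y x z : lt (x, y) -> lt (y, z) -> lt (x, z).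
Proof.
case: fam => -[_ _ h _] _ _ _ _ xy yz; have [Px Py] := ltP xy.
by have [_ Pz] := ltP yz; exact: h xy yz.
Qed.

Let lt_tot x y : P x -> P y -> [\/ lt (x, y), x = y | lt (y, x)].
Proof. by case: fam => -[_ _ _ h] _ _ _ _; exact: h. Qed.

Lemma lopen_min a c d : lt (a, c) -> lt (a, d) ->
  exists2 e, lt (a, e) & lopen lt a e `<=` lopen lt a c `&` lopen lt a d.
Proof.
move=> ac ad; have [_ Pc] := ltP ac; have [_ Pd] := ltP ad.
case: (lt_tot Pc Pd) => [cd|cd|dc].
- exists c => // x [ax xc]; split; split=> //; right.
  by case: xc => [->//|xc]; exact: lt_tr xc cd.
- by exists c => // x h; split=> //; rewrite -cd.
- exists d => // x [ax xd]; split; split=> //; right.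
  by case: xd => [->//|xd]; exact: lt_tr xd dc.
Qed.

(** If a component of [Y] meets every [lopen lt a c], convexity makes it contain one of them.
    Otherwise each of the finitely many components misses such an interval, and the smallest
    interval misses [Y]. *)
Lemma germ_right Y a b : dset Y -> lt (a, b) ->
  exists2 c, lt (a, c) & lopen lt a c `<=` Y \/ lopen lt a c `<=` ~` Y.
Proof.
case: fam => lin dP _ _ _ dY ab; have [YP fin] := dP Y dY.
have [[C [[[CP Cc] CY _] Cacc]]|nacc] := pselect (exists C,
    convex_components P lt Y C /\
    forall c, lt (a, c) -> lopen lt a c `&` C !=set0).
  have [c [[ac cb] Cx]] := Cacc b ab.
  exists c => //; left=> x [ax [->|xc]]; first exact: CY.
  have [y [[ay yx] Cy]] := Cacc x ax; apply: CY.
  case: yx => [<-//|yx]; apply: (Cc y x c) => //; by case: (ltP ax).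
have [|||c ac cP] := @finite_directed _ _ _ [set c | lt (a, c)]
    (fun C c => lopen lt a c `<=` ~` C) fin.
- by exists b.
- move=> c d ac ad; have [e ae eP] := lopen_min ac ad; exists e => //.
  by split=> C h x /eP[]; [move=> /h|move=> _ /h].
- move=> C YC; apply: contrapT => nC; apply: nacc; exists C; split=> // c ac.
  apply: contrapT => nE; apply: nC; exists c => // x acx Cx; apply: nE.
  by exists x.
exists c => //; right=> x acx Yx.
have [C YC Cx] := convex_component_exists lin YP Yx.
exact: cP C YC x acx Cx.
Qed.

(** Points [w] of [Y] with [lopen lt a w] not inside [Y] lie in finitely many components of [Y],
    each above a point outside [Y] that bounds the wanted set. The least such bound [d] exhibits the
    set as the part of [Y] between [a] and [d]; without such [w] it is the part of [Y] above [a]. *)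
Lemma initial_dset Y a : dset Y -> P a ->
  dset [set b | lt (a, b) /\ lopen lt a b `<=` Y].
Proof.
case: fam => lin dP dI _ dray dY Pa; have [YP fin] := dP Y dY.
set Z := [set b | _].
pose W := [set b | lt (a, b) /\ ~ lopen lt a b `<=` Y].
have ZY b : Z b -> Y b by move=> [ab]; apply; split=> //; left.
have [nW|/existsNP[w0 /not_implyP[Ww0 _]]] :=
  pselect (forall b, W b -> ~ Y b).
  have -> : Z = [set b | lt (a, b)] `&` Y.
    apply/seteqP; split=> b; first by move=> /[dup] /ZY Yb [ab _].
    by move=> [/= ab Yb]; split=> //; apply: contrapT => nb; exact: (nW b).
  by apply: dI => //; exact: (dray a Pa).2.
pose Q := [set d | P d /\ forall z, Z z -> lt (z, d)].
have WQ w : W w -> exists2 x, Q x & lopen lt a w x /\ ~ Y x.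
  move=> [aw /existsNP[x /not_implyP[awx nYx]]].
  exists x => //; have [ax _] := awx; have [_ Px] := ltP ax; split=> // z Zz.
  have [az azY] := Zz; have [_ Pz] := ltP az.
  case: (lt_tot Pz Px) => // [zx|xz]; case: nYx; first by rewrite -zx; exact: ZY.
  by apply: azY; split=> //; right.
have [|||d [Pd Zd] dW] := @finite_directed _ _ _ Q
    (fun C d => forall w, C w -> W w -> lt (d, w)) fin.
- by have [x Qx _] := WQ w0 Ww0; exists x.
- move=> c d Qc Qd; have [Pc _] := Qc; have [Pd _] := Qd.
  case: (lt_tot Pc Pd) => [cd|<-|dc]; [exists c|exists c|exists d] => //.
    by split=> C h // w Cw Ww; exact: lt_tr cd (h w Cw Ww).
  by split=> C h // w Cw Ww; exact: lt_tr dc (h w Cw Ww).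
(* A gap [x] of [Y] below one point of [C] is below all of [C], since [C] is convex and avoids
   [x]. *)
- move=> C [[CP Cc] CY _].
  have [[w [Cw Ww]]|nCW] := pselect (exists w, C w /\ W w); last first.
    by have [x Qx _] := WQ w0 Ww0; exists x => // w Cw Ww; case: nCW; exists w.
  have [x Qx [[ax xw] nYx]] := WQ w Ww; exists x => // w' Cw' _.
  have [_ Px] := ltP ax; case: (lt_tot Px (CP w' Cw')) => // [xw'|w'x]; case: nYx.
    by rewrite xw'; exact: CY.
  by case: xw => [->|xw]; apply: CY => //; exact: (Cc w' x w).
have -> : Z = Y `&` ([set b | lt (a, b)] `&` [set b | lt (b, d)]).
  apply/seteqP; split=> b.
    by move=> Zb; split; [exact: ZY|split; [case: Zb|exact: Zd]].
  move=> [Yb [/= ab bd]]; split=> //; apply: contrapT => nb.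
  have [C YC Cb] := convex_component_exists lin YP Yb.
  by have /(lt_tr bd)/lt_irr := dW C YC b Cb (conj ab nb).
by apply: (dI) => //; apply: (dI); [exact: (dray a Pa).2|exact: (dray d Pd).1].
Qed.

End WeaklyOMinimalFamilies.

(** * Transitive automorphism groups *)

(** The iterates of [z] are pairwise distinct members of [F]: by injectivity a repetition would make
    [z] itself an iterate, hence a member of [F]. *)
Lemma not_finite_strict_self_map (X : Type) (F : set X) (z : X) (h : X -> X) :
  injective h -> ~ F z -> F (h z) -> (forall x, F x -> F (h x)) ->
  ~ finite_set F.
Proof.
move=> hinj nFz Fhz Fh Ffin.
have Fiter n : F (iter n.+1 h z) by elim: n => //= n; exact: Fh.
pose f n := iter n.+1 h z.
have finj : injective f.
  move=> m n; wlog mn : m n / m <= n => [hw E|].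
    by case/orP: (leq_total m n) => /hw; [apply|move=> H; exact/esym/H].
  rewrite -(subnKC mn) /f; move: (n - m) => k; case: k => [|k]; first by rewrite addn0.
  have iinj j : injective (iter j h) by elim: j => //= j IH x y /hinj/IH.
  rewrite -addSn iterD => /iinj E; case: nFz; rewrite E; exact: Fiter.
apply: infinite_nat; rewrite -(eq_finite_set (inj_card_eq (f := f) (A := setT) _)).
  by apply: sub_finite_set Ffin => _ [n _ <-]; exact: Fiter.
by move=> x y _ _ /finj.
Qed.

Section TransitiveFamilies.
Variables (X : Type) (P : set X) (lt : set (X * X)) (dset : set (set X)).
Variable Gam : set (X -> X).
Implicit Types (R : set (X * X)) (Y : set X).

Definition preserved R :=
  forall g, Gam g -> forall x y, R (x, y) -> R (g x, g y).

Definition fibers_in R := forall a, P a -> dset [set y | R (a, y)].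

Definition swap R : set (X * X) := [set xy | R (xy.2, xy.1)].

Hypothesis fam : weakly_o_minimal_family P lt dset.
Hypothesis Gam_stable : forall g, Gam g -> forall x, P x -> P (g x).
Hypothesis Gam_inv : forall g, Gam g ->
  exists2 h, Gam h & cancel g h /\ cancel h g.
Hypothesis Gam_transitive : forall a b, P a -> P b -> exists2 g, Gam g & g a = b.
Hypothesis lt_invariant : preserved lt.
Hypothesis fibers_swap : forall R,
  R `<=` P `*` P -> preserved R -> fibers_in R -> fibers_in (swap R).

Let ltP x y : lt (x, y) -> P x /\ P y.
Proof. by case: fam => -[h _ _ _] _ _ _ _ /h. Qed.

Let lt_irr x : ~ lt (x, x).
Proof. by case: fam => -[_ h _ _] _ _ _ _ /[dup] /ltP[Px _]; exact: h. Qed.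

Let lt_tr y x z : lt (x, y) -> lt (y, z) -> lt (x, z).
Proof.
case: fam => -[_ _ h _] _ _ _ _ xy yz; have [Px Py] := ltP xy.
by have [_ Pz] := ltP yz; exact: h xy yz.
Qed.

Let lt_tot x y : P x -> P y -> [\/ lt (x, y), x = y | lt (y, x)].
Proof. by case: fam => -[_ _ _ h] _ _ _ _; exact: h. Qed.

Let fam_rev := rev_weakly_o_minimal_family fam.

Lemma lopen_Gam g a c x : Gam g -> lopen lt a c x -> lopen lt (g a) (g c) (g x).
Proof.
move=> Gg [ax xc]; split; first exact: lt_invariant.
by case: xc => [->|xc]; [left|right; exact: lt_invariant].
Qed.

Lemma rev_lopen_Gam g a c x :
  Gam g -> lopen (rev_order lt) a c x -> lopen (rev_order lt) (g a) (g c) (g x).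
Proof.
move=> Gg [ax xc]; split; first exact: lt_invariant.
by case: xc => [->|xc]; [left|right; exact: lt_invariant].
Qed.

(** Both germs relate a smaller first argument to a larger second one; the base point is the second
    argument here and the first in [right_germ]. *)
Definition left_germ R x :=
  exists2 z, lt (z, x) & lopen (rev_order lt) x z `<=` [set y | R (y, x)].

Definition right_germ R a :=
  exists2 c, lt (a, c) & lopen lt a c `<=` [set x | R (a, x)].

Lemma left_germ_transport R x y : preserved R -> P x -> P y ->
  left_germ R x -> left_germ R y.
Proof.
move=> Rinv Px Py [z zx zR]; have [g Gg <-] := Gam_transitive Px Py.
have [h Gh [gh hg]] := Gam_inv Gg.
exists (g z); first exact: lt_invariant.
move=> w /(rev_lopen_Gam Gh); rewrite !gh => /zR /(Rinv g Gg).
by rewrite /= hg.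
Qed.

Lemma right_germ_transport R x y : preserved R -> P x -> P y ->
  right_germ R x -> right_germ R y.
Proof.
move=> Rinv Px Py [z zx zR]; have [g Gg <-] := Gam_transitive Px Py.
have [h Gh [gh hg]] := Gam_inv Gg.
exists (g z); first exact: lt_invariant.
move=> w /(lopen_Gam Gh); rewrite !gh => /zR /(Rinv g Gg).
by rewrite /= hg.
Qed.

Lemma invariant_initial R : preserved R ->
  preserved [set ab | lt (ab.1, ab.2) /\
                      lopen lt ab.1 ab.2 `<=` [set x | R (ab.1, x)]].
Proof.
move=> Rinv g Gg a b /= [ab abR]; split; first exact: lt_invariant.
have [h Gh [gh hg]] := Gam_inv Gg.
move=> x /(lopen_Gam Gh); rewrite !gh => /abR /(Rinv g Gg).
by rewrite /= hg.
Qed.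

Lemma invariantC R : preserved R -> preserved ((P `*` P) `\` R).
Proof.
move=> Rinv g Gg x y [[/= Px Py] nR]; split; first by split; exact: Gam_stable.
have [h Gh [gh hg]] := Gam_inv Gg.
by move=> /(Rinv h Gh); rewrite !gh.
Qed.

Lemma fibers_inC R : fibers_in R -> fibers_in ((P `*` P) `\` R).
Proof.
have [_ _ _ dC _] := fam => Rfib a Pa.
have -> : [set y | ((P `*` P) `\` R) (a, y)] = P `\` [set y | R (a, y)].
  by apply/seteqP; split=> y /= [] => [[_ Py]|Py] nR.
exact/dC/Rfib.
Qed.

Lemma fibers_in_initial R : fibers_in R ->
  fibers_in [set ab | lt (ab.1, ab.2) /\
                      lopen lt ab.1 ab.2 `<=` [set x | R (ab.1, x)]].
Proof. by move=> Rfib a Pa; exact: (initial_dset fam (Rfib a Pa) Pa). Qed.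

(* If the conclusion fails, then by homogeneity every [a] has a nonempty
   interval [Z(a, _)] to its right on which [R(a, _)] fails.  The convex
   components of [{y | Z(y, b)}] are singletons, because this set misses a left
   neighbourhood of each [c <= b]; hence it is finite.  Choose [z] to the left
   of [b] but above this set, and [c > z] with [Z(z, c)].  Then [{y | Z(y, c)}]
   contains [{y | Z(y, b)}] and the new point [z], whereas an automorphism taking
   [c] to [b] maps it into [{y | Z(y, b)}]. *)
Lemma right_germ_of_left_germ R :
  R `<=` P `*` P -> preserved R -> fibers_in R ->
  (forall x, P x -> left_germ R x) -> forall a, P a -> right_germ R a.
Proof.
move=> RP Rinv Rfib Rleft a Pa; apply: contrapT => nRa.
have [_ dP _ _ _] := fam.
pose N := (P `*` P) `\` R.
pose Z : set (X * X) := [set ab | lt (ab.1, ab.2) /\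
                      lopen lt ab.1 ab.2 `<=` [set x | N (ab.1, x)]].
have lefts b z y : lopen (rev_order lt) b z y -> lt (y, b) by case.
(* The left germs put a smaller point below each point, so transitivity also puts a larger one
   above. *)
have gt_exists x : P x -> exists y, lt (x, y).
  move=> Px; have [z zx _] := Rleft x Px; have [Pz _] := ltP zx.
  by have [g Gg <-] := Gam_transitive Pz Px; exists (g x); exact: lt_invariant.
have Nright b : P b -> right_germ N b.
  move=> Pb; have [c bc] := gt_exists b Pb.
  have [d bd [dR|dR]] := germ_right fam (Rfib b Pb) bc.
    by case: nRa; apply: (right_germ_transport Rinv Pb Pa); exists d.
  exists d => // x bdx; split; last exact: dR.
  by have [/ltP[_ Px] _] := bdx.
have Zinv : preserved Z by exact/invariant_initial/invariantC.
have ZP : Z `<=` P `*` P by move=> [x y] [/ltP[]].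
have Sdset b : P b -> dset [set y | Z (y, b)].
  apply: (fibers_swap ZP Zinv); exact/fibers_in_initial/fibers_inC.
have ZnR y x b : Z (y, b) -> lt (y, x) -> x = b \/ lt (x, b) -> ~ R (y, x).
  by move=> [_ h] yx xb; have [] : N (y, x) by exact: h.
have Sfin b : P b -> finite_set [set y | Z (y, b)].
  move=> Pb; have [SP cfin] := dP _ (Sdset b Pb).
  have -> : [set y | Z (y, b)] =
      \bigcup_(C in convex_components P lt [set y | Z (y, b)]) C.
    apply/seteqP; split=> [y Zy|y [C [_ CS _] /CS//]].
    have [lin _ _ _ _] := fam.
    by have [C hC Cy] := convex_component_exists lin SP Zy; exists C.
  apply: bigcup_finite => // C [[CP Cc] CS _].
  have C1 x c : C x -> C c -> ~ lt (x, c).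
    move=> Cx Cc' xc; have [z zc zR] := Rleft c (CP c Cc').
    have [Pz _] := ltP zc.
    (* A point [y] of [C] this close to [c] satisfies [R (y, c)], which [Z (y, b)] excludes. *)
    have [y [Cy zy]] : exists y, C y /\ lopen (rev_order lt) c z y.
      case: (lt_tot (CP x Cx) Pz) => [xz|xz|zx].
      - by exists z; split; [exact: (Cc x z c)|split; [|left]].
      - by exists x; split=> //; split=> //; left.
      - by exists x; split=> //; split=> //; right.
    apply: (ZnR y c b (CS y Cy)) (lefts _ _ _ zy) _ (zR y zy).
    by right; have [] := CS c Cc'.
  have [->|/set0P[x Cx]] := eqVneq C set0; first exact: finite_set0.
  apply: (@sub_finite_set _ _ [set x]); last exact: finite_set1.
  move=> y Cy; case: (lt_tot (CP x Cx) (CP y Cy)) => [/C1|->|/C1] //; by case.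
have [z za zR] := Rleft a Pa; have [Pz _] := ltP za.
have Slow y : Z (y, a) -> lt (y, z).
  move=> Zy; have [ya _] := Zy; have [Py _] := ltP ya.
  have nzy : ~ lopen (rev_order lt) a z y.
    by move=> /[dup] /lefts _ /zR; apply: (ZnR y a a Zy ya); left.
  by case: (lt_tot Py Pz) => // [yz|zy]; case: nzy; split=> //; [left|right].
have nSz : ~ Z (z, a) by move=> /Slow/lt_irr.
have [c zc zcN] := Nright z Pz; have [_ Pc] := ltP zc.
(* If [c] were not below [a], the interval from [z] to [a] would lie in the one from [z] to [c] and
   give [Z (z, a)]. *)
have ca : lt (c, a).
  case: (lt_tot Pc Pa) => // [ca|ac]; case: nSz; first by rewrite -ca.
  split=> // x [/= zx xa]; apply: zcN; split=> //; right.
  by case: xa => [->//|xa]; exact: lt_tr xa ac.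
have [h Gh hca] := Gam_transitive Pc Pa.
have [k Gk [hk kh]] := Gam_inv Gh.
have Zh y : Z (y, c) -> Z (h y, a) by move=> /(Zinv h Gh); rewrite hca.
apply: (@not_finite_strict_self_map _ [set y | Z (y, a)] z h) (Sfin a Pa).
- exact: can_inj hk.
- exact: nSz.
- exact: Zh.
- move=> y Zy; apply: Zh; have [ya yaN] := Zy.
  have yc := lt_tr (Slow y Zy) zc; split=> // x [/= yx xc].
  apply: yaN; split=> //; right.
  by case: xc => [->//|xc]; exact: lt_tr xc ca.
Qed.

(** [R2] packages [R0] over a whole interval ending at [x], so that its right germ, given by
    [right_germ_of_left_germ], controls all pairs inside an interval and not only those containing
    an endpoint. *)
Lemma uniform_equivalence R0 :
  R0 `<=` P `*` P -> preserved R0 -> fibers_in R0 ->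
  (forall x y z, R0 (x, y) -> R0 (y, z) -> R0 (x, z)) ->
  (exists2 x, P x & left_germ R0 x) ->
  exists E : set (X * X), [/\ equivalence_on P E, E <> id_on P,
    preserved E, fibers_in E
    & forall x y, E (x, y) -> lt (x, y) -> R0 (x, y)].
Proof.
move=> R0P R0inv R0fib R0tr [x0 Px0 R0x0].
have R0left x : P x -> left_germ R0 x.
  by move=> Px; exact: left_germ_transport R0x0.
pose R2 : set (X * X) := [set yx | lt (yx.1, yx.2) /\
  lopen (rev_order lt) yx.2 yx.1 `<=` [set z | R0 (z, yx.2)]].
have R2P : R2 `<=` P `*` P by move=> [x y] [/ltP[]].
have R2inv : preserved R2.
  move=> g Gg y x /= [yx yxR]; split; first exact: lt_invariant.
  have [h Gh [gh hg]] := Gam_inv Gg.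
  move=> z /(rev_lopen_Gam Gh); rewrite !gh => /yxR /(R0inv g Gg).
  by rewrite /= hg.
(* With [x] fixed, the [y] satisfying [R2 (y, x)] form an initial piece for the reversed order, so
   the fibres of [swap R2] are treated first. *)
have R2fib : fibers_in R2.
  apply: (fibers_swap (R := swap R2)).
  - by move=> [x y] /R2P[].
  - by move=> g Gg x y; exact: R2inv.
  - move=> x Px.

    have dR0 : dset [set z | R0 (z, x)] by exact: (fibers_swap R0P R0inv R0fib Px).
    exact: (initial_dset fam_rev dR0 Px).
have R2left x : P x -> left_germ R2 x.
  move=> Px; have [z zx zR] := R0left x Px; exists z => // y [yx zy].
  split=> // w [wx yw]; apply: zR; split=> //.
  case: yw => [->//|yw]; right.
  by case: zy => [<-//|zy]; exact: lt_tr zy yw.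
pose Ep : set (X * X) := [set ab | lt (ab.1, ab.2) /\
                     lopen lt ab.1 ab.2 `<=` [set x | R2 (ab.1, x)]].
have EpP : Ep `<=` P `*` P by move=> [x y] [/ltP[]].
have Epinv : preserved Ep by exact: invariant_initial.
have Epfib : fibers_in Ep by exact: fibers_in_initial.
(* [Ep (a, b)] amounts to [R0] on all increasing pairs of the closed interval from [a] to [b]; in
   this form it restricts and glues. *)
have EpE a b : Ep (a, b) <-> lt (a, b) /\ (forall z x,
    (a = z \/ lt (a, z)) -> lt (z, x) -> (x = b \/ lt (x, b)) -> R0 (z, x)).
  split=> -[ab abR]; split=> //.
    move=> z x az zx xb.
    have ax : lt (a, x) by case: az => [->//|az]; exact: lt_tr zx.
    by have [_] := abR x (conj ax xb); apply; split=> //; case: az; [left|right].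
  move=> x [/= ax xb]; split=> // z [/= zx zy]; apply: abR => //.
  by case: zy; [left|right].
pose E : set (X * X) := Ep `|` swap Ep `|` id_on P.
have Esym x y : E (x, y) -> E (y, x).
  by case=> [[|]|[/= Px <-]]; [left; right|left; left|right].
have Etr x y z : Ep (x, y) -> Ep (y, z) -> Ep (x, z).
  move=> /EpE[xy xyR] /EpE[yz yzR]; apply/EpE; split; first exact: lt_tr yz.
  move=> u v xu uv vz; have [Pu Pv] := ltP uv; have [_ Py] := ltP xy.
  case: (lt_tot Pv Py) => [vy|vy|yv].
  - by apply: xyR => //; right.
  - by apply: xyR => //; left.
  case: (lt_tot Pu Py) => [uy|uy|yu].
  (* A pair straddling [y] is the one case that needs transitivity of [R0]. *)
  - by apply: (R0tr _ y); [apply: xyR => //; left|apply: yzR => //; left].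
  - by apply: yzR => //; left.
  - by apply: yzR => //; right.
have Esub x y z : Ep (x, z) -> lt (x, y) -> lt (y, z) -> Ep (x, y) /\ Ep (y, z).
  move=> /EpE[xz xzR] xy yz; split; apply/EpE; split=> // u v h1 uv h2;
    apply: xzR => //.
    by right; case: h2 => [->//|h2]; exact: lt_tr yz.
  by right; case: h1 => [<-//|h1]; exact: lt_tr h1.
exists E; split.
- split.
  + move=> [x y] [[/EpP//|/EpP[]//]|[/= Px <-]]; by split.
  + by move=> x Px; right.
  + exact: Esym.
  + move=> x y z; case=> [[xy|yx]|[/= Px <-]]; case=> [[yz|zy]|[/= Py <-]]//.
    * by left; left; exact: Etr yz.
    * have [/= Px _] := EpP _ xy; have [/= Pz _] := EpP _ zy.
      case: (lt_tot Px Pz) => [xz|->|zx].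
      -- by left; left; have [] := Esub _ _ _ xy xz (proj1 zy).
      -- by right.
      -- by left; right; have [] := Esub _ _ _ zy zx (proj1 xy).
    * by left; left.
    * have [/= _ Px] := EpP _ yx; have [/= _ Pz] := EpP _ yz.
      case: (lt_tot Px Pz) => [xz|->|zx].
      -- by left; left; have [] := Esub _ _ _ yz (proj1 yx) xz.
      -- by right.
      -- by left; right; have [] := Esub _ _ _ yx (proj1 yz) zx.
    * by left; right; exact: Etr zy yx.
    * by left; right.
    * by left; left.
    * by left; right.
    * by right.
- move=> Eid; have [c x0c cR] := right_germ_of_left_germ R2P R2inv R2fib R2left Px0.
  have : E (x0, c) by left; left; split.
  by rewrite Eid => -[_ /= x0cE]; rewrite x0cE in x0c; exact: lt_irr x0c.
- move=> g Gg x y; case=> [[xy|yx]|[/= Px <-]].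
  + by left; left; exact: Epinv.
  + by left; right; exact: (Epinv g Gg).
  + by right; split=> //; exact: Gam_stable.
- have [_ dP dI dC dray] := fam.
  have dU Y Y' : dset Y -> dset Y' -> dset (Y `|` Y').
    move=> dY dY'; have [[YP _] [YP' _]] := (dP Y dY, dP Y' dY').
    have -> : Y `|` Y' = P `\` ((P `\` Y) `&` (P `\` Y')).
      apply/seteqP; split=> x.
        by case=> h; (split; [auto|case=> -[? ?] [? ?] //]).
      move=> [Px nx]; apply: contrapT => nU; apply: nx; split; split=> // h;
        apply: nU; [left|right] => //.
    by apply: (dC); apply: dI; exact: dC.
  (* The diagonal point is written as the complement of the two open rays at [a], which are in
     [dset]. *)
  move=> a Pa; have -> : [set y | E (a, y)] =
      ([set y | Ep (a, y)] `|` [set y | swap Ep (a, y)])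
      `|` (P `\` ([set y | lt (y, a)] `|` [set y | lt (a, y)])).
    apply/seteqP; split=> y; case=> [|h]; [by left| |by left|]; right.
      by case: h => /= _ <-; split=> //; case; exact: lt_irr.
    case: h => Py nlt; split=> //=.
    by case: (lt_tot Pa Py) => // h; case: nlt; [right|left].
  apply: (dU); first by apply: dU; [exact: Epfib|exact: (fibers_swap EpP Epinv Epfib)].
  by apply: dC; have [] := dray a Pa; exact: dU.
- move=> x y [[/EpE[xy xyR] _|[/= yx _] xy]|[/= Px <-] /lt_irr//].
    by apply: xyR => //; left.
  by case: (lt_irr (lt_tr xy yx)).
Qed.

End TransitiveFamilies.

(** * The locus of a weakly o-minimal type *)

Section LocusOfAType.
Variables (L : language) (T : theory L) (kappa : Type) (M : structure L).
Hypothesis hM : monster T kappa M.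
Variables (A : forall s : lsort L, set (M s)).
Hypothesis hA : small kappa A.
Variables (G : seq (lsort L)) (p : partial_type A G).
Hypothesis pcomplete : complete_type p.

Notation P := (realizations p).
Notation dset := (rel_definable (fun=> setT) P).

Definition aut_action : set (env M G -> env M G) :=
  [set h | exists2 g, fixing_automorphism A g & h = @env_map _ _ _ g G].

Lemma realizations_transfer d e :
  P d -> (forall X, definable A X -> X d -> X e) -> P e.
Proof.
move=> Pd de phi pphi.
by apply: (de [set e | sat (M := expansion A) phi e]); [exists phi|exact: Pd].
Qed.

Lemma aut_action_stable h : aut_action h -> forall x, P x -> P (h x).
Proof.
move=> [g ga ->] x Px; apply: realizations_transfer Px _ => X dX.
by move/(definable_aut ga x dX).
Qed.

Lemma aut_action_inv h :
  aut_action h -> exists2 k, aut_action k & cancel h k /\ cancel k h.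
Proof.
move=> [g ga ->]; have [k ka [gk kg]] := fixing_automorphism_inv ga.
exists (@env_map _ _ _ k G); first by exists k.
by split=> e; rewrite (env_map_comp (k := fun s a => a)) ?env_map_id.
Qed.

(** Completeness of [p] gives any two realizations the same type over [A]. *)
Lemma aut_action_transitive a b : P a -> P b -> exists2 h, aut_action h & h a = b.
Proof.
move=> Pa Pb; have [g ga gab] : exists2 g, fixing_automorphism A g & env_map g a = b.
  apply: (homogeneous hM hA) => X [phi ->] /= Xa.
  case: (pcomplete.2 phi) => [/Pb//|/Pa /=]; by case.
by exists (@env_map _ _ _ g G) => //; exists g.
Qed.

Lemma definable2_aut (H K : seq (lsort L)) (R : set (env M H * env M K)) g :
  fixing_automorphism A g -> definable2 A R ->
  forall x y, R (x, y) -> R (env_map g x, env_map g y).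
Proof.
by move=> ga [phi ->] x y /=; rewrite -env_map_cat; move/(sat_aut ga).
Qed.

Lemma rel_definable2_preserved R :
  rel_definable2 A P P R -> preserved aut_action R.
Proof.
move=> [S dS ->] h ah x y [Sxy [/= Px Py]].
split; last by split; exact: aut_action_stable.
by have [g ga ->] := ah; exact: definable2_aut Sxy.
Qed.

Lemma definable2_fiberl B (H K : seq (lsort L)) (R : set (env M H * env M K)) a :
  definable2 B R -> definable (fun=> setT) [set y | R (a, y)].
Proof.
move=> [phi ->]; apply: (@definable_preimage _ M B _ _ _
  [set e | sat (M := expansion B) phi e] (fun y => env_cat a y)) => //.
  by exists phi.
by apply: subst_fun_cat;
  [apply: subst_fun_const; exact: env_in_setT|exact: subst_fun_id].
Qed.

Lemma definable2_fiberr B (H K : seq (lsort L)) (R : set (env M H * env M K)) a :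
  definable2 B R -> definable (fun=> setT) [set x | R (x, a)].
Proof.
move=> [phi ->]; apply: (@definable_preimage _ M B _ _ _
  [set e | sat (M := expansion B) phi e] (fun y => env_cat y a)) => //.
  by exists phi.
by apply: subst_fun_cat;
  [exact: subst_fun_id|apply: subst_fun_const; exact: env_in_setT].
Qed.

(* Two compactness arguments over a small set containing the parameters of the
   fibre [X]: every point of [X] satisfies some formula over [A] and [a] that
   implies [X], for otherwise homogeneity would move it out of [X]; and finitely
   many such formulas cover [X]. *)
Lemma rel_definable2_of_invariant R a :
  R `<=` P `*` P -> preserved aut_action R -> P a ->
  dset [set y | R (a, y)] -> rel_definable2 A P P R.
Proof.
move=> RP Rinv Pa [Y dY RaY].
have RaE y : P y -> R (a, y) <-> Y y.
  move=> Py; move/seteqP: RaY => [h1 h2]; split=> [/h1[]//|Yy].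
  exact: (h2 y (conj Yy Py)).
have [l _ lY] := definable_finite_params dY.
pose B := add_params (add_params A (entries a)) l.
have hB : small kappa B by do 2![apply: (small_add_params hM)].
have AB s (c : M s) : A c -> B s c by left; left.
have dBY : definable B Y by apply: lY => -[s c]; right.
have dBa W : definable A W -> definable B [set w | W (env_cat a w)].
  move=> dW; apply: (definable_preimage (B := A)) => //; apply: subst_fun_cat.
    apply: subst_fun_const; apply: env_in_of_lookup => s v.
    by left; right; apply/In_entries; exists v.
  exact: subst_fun_id.
have separate z : R (a, z) -> exists W, [/\ definable A W, W (env_cat a z)
    & [set w | W (env_cat a w)] `<=` Y].
  move=> Raz; have [_ /= Pz] := RP _ Raz; apply: contrapT => nW.
  (* A common point [e] would have the type of [z] over [A] and [a], yet lie outside [Y]. *)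
  pose F := [set Z | exists W, [/\ definable A W, W (env_cat a z)
    & Z = [set w | W (env_cat a w)] `&` ~` Y]].
  have [||||e eF] := @saturation_filter _ _ _ _ hM B G F hB.
  - by exists ([set w | True] `&` ~` Y), setT; split=> //; exact: definableT.
  - move=> _ [W [dW _ ->]]; apply: definableI; first exact: dBa.
    exact: definableC.
  - move=> _ [W [dW Wz ->]]; apply: contrapT => ne; apply: nW; exists W; split=> //.
    move=> w Ww; apply: contrapT => nYw; apply: ne; by exists w.
  - move=> _ _ [W [dW Wz ->]] [W' [dW' Wz' ->]].
    exists ([set w | (W `&` W') (env_cat a w)] `&` ~` Y).
      by exists (W `&` W'); split=> //; exact: definableI.
    by split=> w [[]].
  have eW W : definable A W -> W (env_cat a z) -> W (env_cat a e) /\ ~ Y e.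
    move=> dW Wz; exact: (eF ([set w | W (env_cat a w)] `&` ~` Y)
      (ex_intro _ W (And3 dW Wz erefl))).
  have [g ga gz] : exists2 g, fixing_automorphism A g &
      env_map g (env_cat a z) = env_cat a e.
    by apply: (homogeneous hM hA) => W dW /(eW W dW)[].
  rewrite env_map_cat in gz.
  (* Keeping [a] in the tuple forces the automorphism to fix it. *)
  have gaa : env_map g a = a.
    by have := congr1 (@env_left _ _ G G) gz; rewrite !env_left_cat.
  have gze : env_map g z = e.
    by have := congr1 (@env_right _ _ G G) gz; rewrite !env_right_cat.
  have act : aut_action (@env_map _ _ _ g G) by exists g.
  have Rae : R (a, e) by have := Rinv _ act a z Raz; rewrite gaa gze.
  have [_ /= Pe] := RP _ Rae; have [_] := eW _ (definableT _ _) I; apply.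
  exact/RaE.
have [W dW WE] : exists2 W, definable A W &
    forall y, P y -> R (a, y) <-> W (env_cat a y).
  apply: contrapT => nW.
  (* A common point would realize [p], because of the sets [U], lie in [Y], and avoid every set
     [W (env_cat a _)] inside [Y], against [separate]. *)
  pose F := [set Z | exists U W, [/\ definable A U, P `<=` U, definable A W,
    [set w | W (env_cat a w)] `<=` Y
    & Z = (Y `&` U) `&` ~` [set w | W (env_cat a w)]]].
  have [||||e eF] := @saturation_filter _ _ _ _ hM B G F hB.
  - pose W0 := ~` [set: env M (G ++ G)].
    exists ((Y `&` setT) `&` ~` [set w | W0 (env_cat a w)]), setT, W0.
    split=> //; [exact: definableT|exact/definableC/definableT|].
    by move=> w /(_ I).
  - move=> _ [U [W [dU _ dW _ ->]]]; apply: definableI.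
      by apply: definableI => //; exact: sub_definable dU.
    exact/definableC/dBa.
  - move=> _ [U [W [dU PU dW WY ->]]]; apply: contrapT => ne.
    apply: nW; exists W => // y Py; rewrite RaE //; split=> [Yy|]; last exact: WY.
    by apply: contrapT => nWy; apply: ne; exists y; split=> //; split=> //; exact: PU.
  - move=> _ _ [U [W [dU PU dW WY ->]]] [U' [W' [dU' PU' dW' WY' ->]]].
    exists ((Y `&` (U `&` U')) `&` ~` [set w | (~` (~` W `&` ~` W')) (env_cat a w)]).
      exists (U `&` U'), (~` (~` W `&` ~` W')); split=> //.
      + exact: definableI.
      + by move=> x Px; split; [exact: PU|exact: PU'].
      + by apply: definableC; apply: definableI; exact: definableC.
      + move=> w /= nw; apply: contrapT => nYw; apply: nw.
        by split=> [/WY|/WY'].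
    by split=> w [[Yw [Uw U'w]] /contrapT[nW1 nW2]].
  have eUW U W : definable A U -> P `<=` U -> definable A W ->
      [set w | W (env_cat a w)] `<=` Y -> [/\ Y e, U e & ~ W (env_cat a e)].
    move=> dU PU dW WY; have [[]] := eF _ (ex_intro _ U (ex_intro _ W
      (And5 dU PU dW WY erefl))); by split.
  have dF : definable A (~` [set: env M (G ++ G)]) by exact/definableC/definableT.
  have Fsub : [set w | (~` [set: env M (G ++ G)]) (env_cat a w)] `<=` Y.
    by move=> w /(_ I).
  have Pe : P e.
    move=> phi pphi.
    have [] // := eUW [set e | sat (M := expansion A) phi e] _ _ _ dF Fsub.
      by exists phi.
    by move=> x; apply.
  have [Ye _ _] := eUW _ _ (@definableT _ M A G) (fun _ _ => I) dF Fsub.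
  have [W [dW We WY]] := separate e ((RaE e Pe).2 Ye).
  by have [_ _] := eUW _ _ (@definableT _ M A G) (fun _ _ => I) dW WY.
exists [set xy | W (env_cat xy.1 xy.2)].
  by have [phi ->] := dW; exists phi.
(* [W] describes the fibre at [a] only; moving [x] to [a] by an automorphism over [A] extends this
   to all fibres. *)
apply/seteqP; split=> -[x y].
  move=> Rxy; have [/= Px Py] := RP _ Rxy; split=> //=.
  have [h ah hx] := aut_action_transitive Px Pa; have [g ga hg] := ah.
  have := Rinv _ ah x y Rxy; rewrite hx WE; last exact: aut_action_stable.
  by rewrite -hx hg -env_map_cat => /(definable_aut ga _ dW).
move=> [/= Wxy [/= Px Py]].
have [h ah xh] := aut_action_transitive Px Pa; have [g ga hg] := ah.
have [k ak [hk kh]] := aut_action_inv ah.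
have Ray : R (a, h y).
  apply/WE; first exact: aut_action_stable.
  by rewrite -xh hg -env_map_cat; apply/(definable_aut ga _ dW).
by have := Rinv _ ak _ _ Ray; rewrite -xh !hk.
Qed.

(** [rel_definable2_of_invariant] yields a formula in both variables, which gives access to the
    fibres in the other one. *)
Lemma definable_fibers_swap R :
  R `<=` P `*` P -> preserved aut_action R -> fibers_in P dset R ->
  fibers_in P dset (swap R).
Proof.
move=> RP Rinv Rfib a Pa.
have [S dS RE] := rel_definable2_of_invariant RP Rinv Pa (Rfib a Pa).
exists [set x | S (x, a)]; first exact: definable2_fiberr dS.
by rewrite RE; apply/seteqP; split=> x /= [Sx]; [move=> [/=]|].
Qed.

Variable ltp : set (env M G * env M G).
Hypothesis hp : weakly_o_minimal_pair p ltp.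

Lemma pair_weakly_o_minimal_family : weakly_o_minimal_family P ltp dset.
Proof.
have [_ [S dS ltE] lin fin] := hp; split=> //.
- by move=> Y dY; split; [case: dY => Y' _ ->; exact: subIsetr|exact: fin].
- move=> _ _ [Y dY ->] [Z dZ ->]; exists (Y `&` Z); first exact: definableI.
  by rewrite setIACA setIid.
- move=> _ [Y dY ->]; exists (~` Y); first exact: definableC.
  apply/seteqP; split=> x /= [h1 h2]; split=> //; first by move=> Yx; exact: h2.
  by case.
- move=> a Pa; split; [exists [set x | S (x, a)]|exists [set x | S (a, x)]].
  + exact: definable2_fiberr dS.
  + by rewrite ltE; apply/seteqP; split=> x /= [Sx]; [move=> [/=]|].
  + exact: definable2_fiberl dS.
  + by rewrite ltE; apply/seteqP; split=> x /= [Sx]; [move=> [/=]|].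
Qed.

(** * The relations that comparing values of [f] induces on the locus *)

Variables (H : seq (lsort L)) (D : set (env M H)).
Variables (ltD : set (env M H * env M H)) (f : env M G -> env M H).
Hypotheses (hD : definable A D) (hltD : definable2 A ltD).
Hypothesis hDlin : linear_order D ltD.
Hypothesis hfD : set_fun P D f.
Hypothesis hf : rel_definable2 A P D (graph_on P f).

Definition lt_image : set (env M G * env M G) :=
  [set xy | (P xy.1 /\ P xy.2) /\ ltD (f xy.1, f xy.2)].

Lemma lt_image_sub : lt_image `<=` P `*` P.
Proof. by move=> [x y] []. Qed.

(** The graph of [f] is the trace of an [A]-definable relation on sets stable under automorphisms
    over [A]. *)
Lemma fun_aut g x :
  fixing_automorphism A g -> P x -> f (env_map g x) = env_map g (f x).
Proof.
move=> ga Px; have [S dS gE] := hf.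
have [Sx [_ Dfx]] : (S `&` (P `*` D)) (x, f x) by rewrite -gE.
have Pgx : P (env_map g x) by apply: (aut_action_stable _ Px); exists g.
have : graph_on P f (env_map g x, env_map g (f x)).
  rewrite gE; split; first exact: definable2_aut ga dS _ _ Sx.
  by split=> //; apply/(definable_aut ga _ hD).
by case.
Qed.

Lemma lt_image_preserved : preserved aut_action lt_image.
Proof.
move=> h ah x y [[/= Px Py] fxy]; split; first by split; exact: aut_action_stable.
have [g ga ->] := ah; rewrite /= !fun_aut //.
exact: definable2_aut ga hltD _ _ fxy.
Qed.

Lemma lt_image_fibers : fibers_in P dset lt_image.
Proof.
move=> a Pa; have [S dS gE] := hf.
(* Outside the product of [P] and [D] the relation [S] may differ from the graph; below, [ltD]
   forces [v] into [D]. *)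
have Sgraph y v : P y -> D v -> S (y, v) <-> v = f y.
  move=> Py Dv; split=> [Syv|->].
    have : graph_on P f (y, v) by rewrite gE.
    by case.
  by have [] : (S `&` (P `*` D)) (y, f y) by rewrite -gE.
(* The quantified tuple comes first, as [definable_exists] expects. *)
pose X : set (env M (H ++ G)) :=
  [set e | S (env_right e, env_left e)] `&` [set e | ltD (f a, env_left e)].
have dX : definable (fun=> setT) X.
  apply: definableI.
    have [phi ->] := dS.
    apply: (@definable_preimage _ M A _ _ _ [set e | sat (M := expansion A) phi e]
      (fun e : env M (H ++ G) => env_cat (env_right e) (env_left e))) => //.
      by exists phi.
    by apply: subst_fun_cat; [exact: subst_fun_right|exact: subst_fun_left].
  apply: (@definable_preimage _ M (fun=> setT) _ _ _ [set v | ltD (f a, v)]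
    (@env_left _ _ H G)) => //; first exact: definable2_fiberl hltD.
  exact: subst_fun_left.
exists [set y | exists v, X (env_cat v y)]; first exact: definable_exists.
have [ltDD _ _ _] := hDlin.
apply/seteqP; split=> y.
  move=> [[_ /= Py] fay]; split=> //; exists (f y).
  rewrite /X /= env_left_cat env_right_cat; split=> //.
  by apply/Sgraph => //; exact: hfD.
move=> [[v]]; rewrite /X /= env_left_cat env_right_cat => -[Syv av] Py.
have [_ /= Dv] := ltDD _ av.
by split=> //=; move: av; rewrite ((Sgraph y v Py Dv).1 Syv).
Qed.

Definition eq_image : set (env M G * env M G) :=
  [set xy | (P xy.1 /\ P xy.2) /\ f xy.1 = f xy.2].

(** Linearity of [ltD] turns equality of images into two negations, so its fibres call for no new
    formula. *)
Lemma eq_imageE :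
  eq_image = ((P `*` P) `\` lt_image) `&` ((P `*` P) `\` swap lt_image).
Proof.
have [_ irr _ tot] := hDlin.
apply/seteqP; split=> -[x y] /=.
  move=> [[/= Px Py] fxy]; split; split=> //= -[_ /=]; rewrite fxy;
    apply: irr; exact: hfD.
move=> [[[/= Px Py] n1] [_ n2]]; split=> //=.
by case: (tot (f x) (f y) (hfD Px) (hfD Py)) => // h; [case: n1|case: n2].
Qed.

Lemma eq_image_preserved : preserved aut_action eq_image.
Proof.
move=> h ah x y [[/= Px Py] fxy]; split; first by split; exact: aut_action_stable.
by have [g ga ->] := ah; rewrite /= !fun_aut // fxy.
Qed.

Lemma eq_image_fibers : fibers_in P dset eq_image.
Proof.
have fam := pair_weakly_o_minimal_family.
have [_ _ dI _ _] := fam.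
move=> a Pa; rewrite eq_imageE.
have -> : [set y | (((P `*` P) `\` lt_image) `&`
    ((P `*` P) `\` swap lt_image)) (a, y)] =
  [set y | ((P `*` P) `\` lt_image) (a, y)] `&`
  [set y | ((P `*` P) `\` swap lt_image) (a, y)] by [].
apply: dI; apply: (fibers_inC fam) => //; first exact: lt_image_fibers.
apply: definable_fibers_swap;
  [exact: lt_image_sub|exact: lt_image_preserved|exact: lt_image_fibers].
Qed.

(** The germ dichotomy is applied, in the reversed order, to the conditions that [f y] is below and
    above [f x]; if both fail near [x], equality is left. *)
Lemma left_germ_trichotomy x z : ltp (z, x) ->
  [\/ left_germ ltp eq_image x, left_germ ltp lt_image x
    | left_germ ltp (swap lt_image) x].
Proof.
move=> zx; have fam := pair_weakly_o_minimal_family.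
have [[ltP _ _ _] _ _ _ _] := fam; have [/= Pz Px] := ltP _ zx.
have famr := rev_weakly_o_minimal_family fam.
have fibs := definable_fibers_swap lt_image_sub lt_image_preserved lt_image_fibers.
have [c cx [cR|cR]] := germ_right famr (fibs x Px) zx.
  by constructor 2; exists c.
have [d dx [dR|dR]] := germ_right famr (lt_image_fibers Px) zx.
  by constructor 3; exists d.
constructor 1; have [e ex eP] := lopen_min famr cx dx.
exists e => // y eyx; have [/cR n1 /dR n2] := eP y eyx.
have [/ltP[/= Py _] _] := eyx.
by rewrite /= eq_imageE.
Qed.

End LocusOfAType.

Theorem theorem3p5 (L : language) (T : theory L) (hT : complete_theory T)
    (kappa : Type) (M : structure L) (hM : monster T kappa M)
    (A : forall s : lsort L, set (M s)) (hA : small kappa A)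
    (G : seq (lsort L)) (p : partial_type A G) (ltp : set (env M G * env M G))
    (hp : weakly_o_minimal_pair p ltp)
    (H : seq (lsort L)) (D : set (env M H)) (ltD : set (env M H * env M H))
    (hD : definable A D) (hltD : definable2 A ltD)
    (hDlin : linear_order D ltD)
    (f : env M G -> env M H) (hfD : set_fun (realizations p) D f)
    (hf : rel_definable2 A (realizations p) D (graph_on (realizations p) f))
    (hfnc : ~ constant_on (realizations p) f) :
  exists E : set (env M G * env M G),
    [/\ definable_equivalences p E,
        E <> id_on (realizations p)
      & forall x : env M G, realizations p x ->
          constant_on [set y | E (x, y)] f \/
          strictly_monotone_on [set y | E (x, y)] ltp ltD f].
Proof.
have [pc dlt [ltP _ _ tot] _] := hp.
have fam := pair_weakly_o_minimal_family hp.
have stable := @aut_action_stable _ M A G p.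
have transitive := @aut_action_transitive _ _ _ _ hM _ hA _ _ pc.
have swapped := @definable_fibers_swap _ _ _ _ hM _ hA _ _ pc.
have lt_preserved := rel_definable2_preserved dlt.
have Rsub := @lt_image_sub _ M A G p H ltD f.
have Rpres := lt_image_preserved hD hltD hf.
have Rfib := lt_image_fibers hltD hDlin hfD hf.
have unif := uniform_equivalence fam stable (@aut_action_inv _ M A G)
  transitive lt_preserved swapped.
(* Non-constancy of [f] provides two distinct points, so [y0] has a point to its left. *)
have [x0 [y0 [Px0 Py0 xy0]]] : exists x y, [/\ realizations p x,
    realizations p y & ltp (x, y)].
  apply: contrapT => nlt; apply: hfnc => x y Px Py.
  by case: (tot x y Px Py) => [h|-> //|h]; case: nlt; [exists x, y|exists y, x].
(* The three cases differ only in [R] and in what [R] on a class says about [f]. *)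
have conclude R : R `<=` realizations p `*` realizations p ->
    preserved (@aut_action L M A G) R ->
    fibers_in (realizations p) (rel_definable (fun=> setT) (realizations p)) R ->
    (forall x y z, R (x, y) -> R (y, z) -> R (x, z)) ->
    left_germ ltp R y0 ->
    (forall K, K `<=` realizations p ->
       (forall x y, K x -> K y -> ltp (x, y) -> R (x, y)) ->
       constant_on K f \/ strictly_monotone_on K ltp ltD f) ->
    exists E : set (env M G * env M G),
    [/\ definable_equivalences p E,
        E <> id_on (realizations p)
      & forall x : env M G, realizations p x ->
          constant_on [set y | E (x, y)] f \/
          strictly_monotone_on [set y | E (x, y)] ltp ltD f].
  move=> RP Rinv RF Rtr Rleft RK.
  have [E [Eeq Eid Epres Efib ER]] :=
    unif R RP Rinv RF Rtr (ex_intro2 _ _ y0 Py0 Rleft).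
  have [EP _ Esym Etr] := Eeq.
  exists E; split=> //.
    split=> //; exact: (rel_definable2_of_invariant hM hA pc EP Epres Px0 (Efib x0 Px0)).
  move=> x Px; apply: RK => [y /EP[]//|y z xy xz].
  by apply: ER; apply: Etr xz; exact: Esym.
have [ltDD Dirr Dtr Dtot] := hDlin.
have lt_trans : forall x y z, lt_image p ltD f (x, y) ->
    lt_image p ltD f (y, z) -> lt_image p ltD f (x, z).
  move=> x y z [[/= Px Py] xy] [[/= _ Pz] yz]; split=> //=.
  exact: (Dtr _ _ _ (hfD _ Px) (hfD _ Py) (hfD _ Pz) xy yz).
(* The three germs make [f] constant, strictly increasing and strictly decreasing on the classes, in
   this order. *)
case: (left_germ_trichotomy hM hA pc hp hD hltD hDlin hfD hf xy0) => germ.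
- apply: conclude germ _.
  + by move=> [x y] [].
  + exact: eq_image_preserved hD hf.
  + exact: (eq_image_fibers hM hA pc hp hD hltD hDlin hfD hf).
  + move=> x y z [[/= Px Py] xy] [[/= _ Pz] yz]; split=> //=.
    exact: etrans xy yz.
  move=> K KP KR; left=> x y Kx Ky.
  by case: (tot x y (KP x Kx) (KP y Ky)) => [/KR[]|->|/KR[]].
- apply: conclude germ _ => //.
  by move=> K KP KR; right; left=> x y Kx Ky /KR[].
- apply: conclude germ _.
  + by move=> [x y] /Rsub[].
  + by move=> h ah x y; exact: Rpres.
  + exact: swapped.
  + by move=> x y z yx zy; exact: lt_trans zy yx.
  by move=> K KP KR; right; right=> x y Kx Ky /KR[].
Qed.
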